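(* Let $k$ be an algebraically closed field and let $A$ be a finite-dimensional $k$-algebra of non-wild representation type, with separated quiver $Q^s$. (1) If $\operatorname{char}(k)=2$, then $\mathrm{HH}^1_{\mathrm{rad}}(A)$ is a solvable Lie algebra. (2) If $\operatorname{char}(k)\neq 2$, then $\mathrm{HH}^1_{\mathrm{rad}}(A)$ is solvable if the underlying graph $\overline{Q^s}$ does not contain an $\widetilde{A}_1$.
   Context: Non-wild means of finite or tame representation type. If $Q$ is the (Gabriel) quiver of $A$, the separated quiver $Q^s$ has vertices $i,i'$ for each vertex $i$ of $Q$ and one arrow $a^s: s(a)\to t(a)'$ for each arrow $a$ of $Q$. $\overline{Q^s}$ is the underlying undirected graph; $\widetilde{A}_1$ is the graph with two vertices joined by two edges. $\mathrm{Der}_{\mathrm{rad}}(A)$ is the Lie algebra (under the commutator) of $k$-linear derivations $\delta$ of $A$ with $\delta(\mathrm{rad}(A))\subseteq\mathrm{rad}(A)$, $\mathrm{rad}(A)$ the Jacobson radical; $\mathrm{Inn}(A)$ is the Lie ideal of inner derivations; $\mathrm{HH}^1_{\mathrm{rad}}(A)=\mathrm{Der}_{\mathrm{rad}}(A)/\mathrm{Inn}(A)$. *)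

(* Defs.v *)
From HB Require Import structures.
From mathcomp Require Import all_boot all_order all_algebra all_field.
From mathcomp Require Import generic_quotient ring_quotient.
From mathcomp Require Import boolp classical_sets.

Set Implicit Arguments.
Unset Strict Implicit.
Unset Printing Implicit Defensive.

Import GRing.Theory.
Local Open Scope ring_scope.
Local Open Scope quotient_scope.

HB.mixin Record Lmodule_isLie (K : comNzRingType) L of GRing.Lmodule K L := {
  lie : L -> L -> L;
  lie_linearl : forall (c : K) (x y z : L),
    lie (c *: x + y) z = c *: lie x z + lie y z;
  lie_linearr : forall (c : K) (x y z : L),
    lie z (c *: x + y) = c *: lie z x + lie z y;
  liexx : forall x : L, lie x x = 0;
  lie_jacobi : forall x y z : L,
    lie x (lie y z) + lie y (lie z x) + lie z (lie x y) = 0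
}.

#[short(type="lieAlgType")]
HB.structure Definition LieAlgebra (K : comNzRingType) :=
  {L of GRing.Lmodule K L & Lmodule_isLie K L}.

Section LieTheory.
Context (K : comNzRingType) (L : lieAlgType K).
Implicit Types (x y z : L) (U : set L).

Lemma lieDl x y z : lie (x + y) z = lie x z + lie y z.
Proof. by rewrite -[x in LHS]scale1r lie_linearl scale1r. Qed.

Lemma lieDr x y z : lie z (x + y) = lie z x + lie z y.
Proof. by rewrite -[x in LHS]scale1r lie_linearr scale1r. Qed.

Lemma lieC x y : lie x y = - lie y x.
Proof.
apply/eqP; rewrite -addr_eq0; have := liexx (x + y).
by rewrite lieDl !lieDr !liexx addr0 add0r => ->.
Qed.

Lemma lieNl x z : lie (- x) z = - lie x z.
Proof.
have lie0 : lie 0 z = 0 by apply: (addrI (lie 0 z)); rewrite -lieDl !addr0.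
by apply/eqP; rewrite -addr_eq0 -lieDl addNr lie0.
Qed.

Lemma lieBl x y z : lie (x - y) z = lie x z - lie y z.
Proof. by rewrite lieDl lieNl. Qed.

Lemma lieBr x y z : lie z (x - y) = lie z x - lie z y.
Proof. by rewrite lieC lieBl opprB (lieC z x) (lieC z y) opprK addrC. Qed.

Definition is_subspace U :=
  U 0 /\ forall (c : K) x y, U x -> U y -> U (c *: x + y).

(* [U, U]: the linear span of all brackets of elements of U *)
Definition derived_subalg U : set L :=
  smallest is_subspace [set lie x y | x in U & y in U]%classic.

Definition derived_series n : set L := iter n derived_subalg setT.

Definition lie_solvable := exists n, derived_series n = [set 0]%classic.

End LieTheory.

Arguments lie_solvable {K} L.

Record lieIdeal (K : comNzRingType) (L : lieAlgType K) := LieIdeal {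
  lie_ideal_pred :> zmodClosed L;
  lie_idealZ : forall (c : K) x, x \in lie_ideal_pred -> c *: x \in lie_ideal_pred;
  lie_idealM : forall x y, y \in lie_ideal_pred -> lie x y \in lie_ideal_pred
}.

Definition lie_quot (K : comNzRingType) (L : lieAlgType K) (I : lieIdeal L) :=
  Quotient.quot (lie_ideal_pred I).

Section LieQuotient.
Context (K : comNzRingType) (L : lieAlgType K) (I : lieIdeal L).
Local Notation Q := (lie_quot I).

HB.instance Definition _ := GRing.Zmodule.on Q.
HB.instance Definition _ := EqQuotient.on Q.
HB.instance Definition _ := ZmodQuotient.on Q.

Lemma eq_pi (x y : L) : x - y \in I -> \pi_Q x = \pi_Q y.
Proof. by rewrite Quotient.idealrBE => /eqP. Qed.

Lemma repr_pi (x : L) : repr (\pi_Q x) - x \in I.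
Proof. by rewrite Quotient.idealrBE reprK. Qed.

Definition qscale (c : K) (q : Q) : Q := \pi_Q (c *: repr q).
Definition qlie (p q : Q) : Q := \pi_Q (lie (repr p) (repr q)).

Lemma pi_scale c (x : L) : qscale c (\pi_Q x) = \pi_Q (c *: x).
Proof. by apply: eq_pi; rewrite -scalerBr; exact/lie_idealZ/repr_pi. Qed.

Lemma pi_lie (x y : L) : qlie (\pi_Q x) (\pi_Q y) = \pi_Q (lie x y).
Proof.
apply: eq_pi; set x' := repr _; set y' := repr _.
have -> : lie x' y' - lie x y = lie x' (y' - y) + lie (x' - x) y.
  by rewrite lieBr lieBl addrA subrK.
apply: rpredD; first exact: lie_idealM (repr_pi y).
by rewrite lieC rpredN; exact: lie_idealM (repr_pi x).
Qed.

Let pi_add (x y : L) : \pi_Q x + \pi_Q y = \pi_Q (x + y).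
Proof. exact: esym (Quotient.pi_add (lie_ideal_pred I) x y). Qed.

Let pi0 : \pi_Q 0 = 0 :> Q.
Proof. by apply: (addrI (\pi_Q 0)); rewrite pi_add !addr0. Qed.

Fact qscaleA a b (v : Q) : qscale a (qscale b v) = qscale (a * b) v.
Proof.
by rewrite -[v]reprK (pi_scale b (repr v)) (pi_scale (a * b)) pi_scale scalerA.
Qed.
Fact qscale1 : left_id 1 qscale.
Proof. by move=> v; rewrite -[v]reprK pi_scale scale1r. Qed.
Fact qscaleDr : right_distributive qscale +%R.
Proof.
move=> a u v; rewrite -[u]reprK -[v]reprK pi_add (pi_scale a (repr u)).
by rewrite (pi_scale a (repr v)) pi_add pi_scale scalerDr.
Qed.
Fact qscaleDl (v : Q) : {morph qscale^~ v : a b / a + b}.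
Proof.
move=> a b; rewrite -[v]reprK (pi_scale a (repr v)) (pi_scale b (repr v)).
by rewrite pi_add pi_scale scalerDl.
Qed.

HB.instance Definition _ :=
  GRing.Zmodule_isLmodule.Build K Q qscaleA qscale1 qscaleDr qscaleDl.

Fact qlie_linearl (c : K) (x y z : Q) :
  qlie (c *: x + y) z = c *: qlie x z + qlie y z.
Proof.
rewrite -[x]reprK -[y]reprK -[z]reprK.
move: (repr x) (repr y) (repr z) => {}x {}y {}z.
rewrite (pi_lie x z) (pi_lie y z) [c *: \pi_Q x](pi_scale c x).
rewrite [c *: \pi_Q (lie x z)](pi_scale c (lie x z)) !pi_add.
by rewrite pi_lie lie_linearl.
Qed.
Fact qlie_linearr (c : K) (x y z : Q) :
  qlie z (c *: x + y) = c *: qlie z x + qlie z y.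
Proof.
rewrite -[x]reprK -[y]reprK -[z]reprK.
move: (repr x) (repr y) (repr z) => {}x {}y {}z.
rewrite (pi_lie z x) (pi_lie z y) [c *: \pi_Q x](pi_scale c x).
rewrite [c *: \pi_Q (lie z x)](pi_scale c (lie z x)) !pi_add.
by rewrite pi_lie lie_linearr.
Qed.
Fact qliexx (x : Q) : qlie x x = 0.
Proof. by rewrite -[x]reprK pi_lie liexx pi0. Qed.
Fact qlie_jacobi (x y z : Q) :
  qlie x (qlie y z) + qlie y (qlie z x) + qlie z (qlie x y) = 0.
Proof.
rewrite -[x]reprK -[y]reprK -[z]reprK.
move: (repr x) (repr y) (repr z) => {}x {}y {}z.
rewrite (pi_lie y z) (pi_lie z x) (pi_lie x y).
rewrite (pi_lie x (lie y z)) (pi_lie y (lie z x)) (pi_lie z (lie x y)).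
by rewrite !pi_add lie_jacobi pi0.
Qed.

HB.instance Definition _ :=
  Lmodule_isLie.Build K Q qlie_linearl qlie_linearr qliexx qlie_jacobi.

End LieQuotient.

Section Radical.
Context (K : fieldType) (A : falgType K).
Implicit Types (M N : {vspace A}).

(* Since A is unital, every left ideal is a K-subspace. *)
Definition left_ideal M := (fullv * M <= M)%VS.

Definition maximal_left_ideal M :=
  [/\ left_ideal M, M != fullv &
      forall N, left_ideal N -> (M <= N)%VS -> N = M \/ N = fullv].

Lemma vspace_inter (P : {vspace A} -> Prop) :
  exists J : {vspace A}, forall x, x \in J <-> forall M, P M -> x \in M.
Proof.
suff H n (U : {vspace A}) : (\dim U < n)%N ->
    exists J : {vspace A},
      forall x, x \in J <-> x \in U /\ forall M, P M -> x \in M.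
  have [J HJ] := H _ fullv (ltnSn _); exists J => x.
  by rewrite HJ; split=> [[]//|h]; split=> //; exact: memvf.
elim: n U => // n IHn U; rewrite ltnS => leUn.
have [allU|] := pselect (forall M, P M -> (U <= M)%VS).
  exists U => x; split=> [Ux|[]//]; split=> // M /allU /subvP; exact.
move=> /existsNP[M /not_implyP[PM /negP UM]].
have [|J HJ] := IHn (U :&: M)%VS.
  apply: leq_trans leUn; rewrite ltn_neqAle dimvS ?capvSl // andbT.
  apply: contra UM => /eqP dUM.
  have /eqP <- : (U :&: M == U)%VS by rewrite eqEdim capvSl dUM leqnn.
  exact: capvSr.
exists J => x; rewrite HJ memv_cap.
split=> [[/andP[-> _]]|[-> h]]; split=> //.
exact: h.
Qed.

Definition jrad : {vspace A} := projT1 (cid (vspace_inter maximal_left_ideal)).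

Lemma jradP x : x \in jrad <-> forall M, maximal_left_ideal M -> x \in M.
Proof. exact: (projT2 (cid (vspace_inter maximal_left_ideal))). Qed.

Lemma left_idealP M : reflect (forall a x, x \in M -> a * x \in M) (left_ideal M).
Proof.
apply: (iffP prodvP) => [h a x|h a x _]; first by apply: h; rewrite memvf.
exact: h.
Qed.

Lemma jrad_mull a x : x \in jrad -> a * x \in jrad.
Proof.
move=> /jradP xJ; apply/jradP => M Mmax; have [/left_idealP ML _ _] := Mmax.
exact/ML/xJ.
Qed.

Lemma jrad_mulr x b : x \in jrad -> x * b \in jrad.
Proof.
move=> /jradP xJ; apply/jradP => M [/left_idealP ML Mproper Mmax].
have [bM|bM] := boolP (b \in M); first exact: ML.
pose N := (amulr b @^-1: M)%VS.
have NE a : (a \in N) = (a * b \in M) by rewrite -memv_preim lfunE.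
rewrite -NE; apply: xJ; split.
- by apply/left_idealP => a y; rewrite !NE -mulrA; exact: ML.
- by apply: contraNneq bM => NT; rewrite -[b]mul1r -NE NT memvf.
move=> N' /left_idealP N'L NN'.
have [N'N|/subvPn[n' n'N' n'N]] := boolP (N' <= N)%VS.
  by left; apply/eqP; rewrite eqEsubv N'N.
right; pose M' := (M + amulr (n' * b) @: fullv)%VS.
have M'T : M' = fullv.
  have [||eqM|//] := Mmax M'.
  - apply/left_idealP => a _ /memv_addP[m mM [_ /memv_imgP[c _ ->] ->]].
    rewrite mulrDr memv_add ?ML // !lfunE /= mulrA.
    have := memv_img (amulr (n' * b)) (memvf (a * c)).
    by rewrite lfunE.
  - exact: addvSl.
  - case/negP: n'N; rewrite NE -eqM.
    have := memv_img (amulr (n' * b)) (memvf 1).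
    by rewrite lfunE /= mul1r; exact/subvP/addvSr.
have /memv_addP[m mM [_ /memv_imgP[c _ ->]]] : b \in M' by rewrite M'T memvf.
rewrite lfunE /= mulrA => bE.
have sN : 1 - c * n' \in N by rewrite NE mulrBl mul1r {1}bE addrK.
have N'1 : 1 \in N'.
  rewrite -[1](subrK (c * n')) rpredD ?N'L //; exact: (subvP NN').
apply/eqP; rewrite eqEsubv subvf /=; apply/subvP => a _.
by rewrite -[a]mulr1 N'L.
Qed.

End Radical.

Section Derivations.
Context (K : fieldType) (A : falgType K).
Implicit Types (d : 'End(A)) (a : A).

Definition is_derivation d := forall x y, d (x * y) = d x * y + x * d y.

Definition der_rad : pred 'End(A) :=
  fun d => `[< is_derivation d >] && (d @: jrad A <= jrad A)%VS.

Lemma der_radP d :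
  reflect (is_derivation d /\ forall x, x \in jrad A -> d x \in jrad A)
          (d \in der_rad).
Proof.
apply: (iffP andP) => [[/asboolP dD /subvP dJ]|[dD dJ]]; split=> //.
- by move=> x xJ; apply/dJ/memv_img.
- exact/asboolP.
- by apply/subvP => _ /memv_imgP[x xJ ->]; exact: dJ.
Qed.

Fact der_rad_submod : submod_closed der_rad.
Proof.
split=> [|c d e /der_radP[dD dJ] /der_radP[eD eJ]]; apply/der_radP; split.
- by move=> x y; rewrite !lfunE /= mul0r mulr0 addr0.
- by move=> x _; rewrite lfunE rpred0.
- move=> x y; rewrite !lfunE /= !lfunE /= dD eD scalerDr mulrDl mulrDr.
  by rewrite -scalerAl -scalerAr addrACA.
- by move=> x xJ; rewrite !lfunE /= !lfunE /= rpredD ?rpredZ ?dJ ?eJ.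
Qed.

HB.instance Definition _ :=
  GRing.isSubmodClosed.Build K 'End(A) der_rad der_rad_submod.

Record DerRad := MkDerRad { der_val :> 'End(A); _ : der_val \in der_rad }.

HB.instance Definition _ := [isSub for der_val].
HB.instance Definition _ := [Choice of DerRad by <:].
HB.instance Definition _ := [SubChoice_isSubZmodule of DerRad by <:].
HB.instance Definition _ := [SubZmodule_isSubLmodule of DerRad by <:].

Definition lfun_comm d e : 'End(A) := ((d \o e) - (e \o d))%VF.

Lemma commE d e x : lfun_comm d e x = d (e x) - e (d x).
Proof. by rewrite /lfun_comm add_lfunE opp_lfunE !comp_lfunE. Qed.

Fact comm_der_rad_aux (V : zmodType) (a b c f p q : V) :
  (a + b + (c + f)) - (p + c + (b + q)) = a - p + (f - q).
Proof.
rewrite [X in X - _ = _](AC (2*2) (1*4*(2*3))) /=.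
rewrite [X in _ - X = _](AC (2*2) (1*4*(3*2))) /=.
by rewrite opprD [LHS]addrACA subrr addr0 opprD [LHS]addrACA.
Qed.

Fact comm_der_rad d e :
  d \in der_rad -> e \in der_rad -> lfun_comm d e \in der_rad.
Proof.
move=> /der_radP[dD dJ] /der_radP[eD eJ].
apply/der_radP; split=> [x y|x xJ]; rewrite !commE; last first.
  by apply: rpredB; [apply/dJ/eJ | apply/eJ/dJ].
rewrite eD dD !linearD /= !dD !eD mulrBl mulrBr.
rewrite -opprD; exact: comm_der_rad_aux.
Qed.

Definition der_rad_lie (d e : DerRad) := MkDerRad (comm_der_rad (valP d) (valP e)).

Let der_lieE (d e : DerRad) x : der_rad_lie d e x = d (e x) - e (d x).
Proof. exact: commE. Qed.

Let der_addE (d e : DerRad) x : (d + e) x = d x + e x.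
Proof. exact: (add_lfunE (der_val d) (der_val e)). Qed.

Let der_scaleE c (d : DerRad) x : (c *: d) x = c *: d x.
Proof. exact: (scale_lfunE c (der_val d)). Qed.

Let der_eqP (d e : DerRad) : (forall x, d x = e x) -> d = e.
Proof. by move=> de; apply/val_inj/lfunP. Qed.

Fact der_lie_linearl (c : K) (d e f : DerRad) :
  der_rad_lie (c *: d + e) f = c *: der_rad_lie d f + der_rad_lie e f.
Proof.
apply: der_eqP => x; rewrite !(der_lieE, der_addE, der_scaleE).
by rewrite linearD linearZ /= scalerBr opprD addrACA.
Qed.

Fact der_lie_linearr (c : K) (d e f : DerRad) :
  der_rad_lie f (c *: d + e) = c *: der_rad_lie f d + der_rad_lie f e.
Proof.
apply: der_eqP => x; rewrite !(der_lieE, der_addE, der_scaleE).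
by rewrite linearD linearZ /= scalerBr opprD addrACA.
Qed.

Fact der_liexx (d : DerRad) : der_rad_lie d d = 0.
Proof. by apply: der_eqP => x; rewrite der_lieE subrr lfunE. Qed.

Fact der_lie_jacobi_aux (V : zmodType) (a b c p q r : V) :
  a - b - (c - p) + (c - q - (r - b)) + (r - p - (a - q)) = 0.
Proof.
rewrite !opprB [LHS](AC ((2*2)*(2*2)*(2*2))
  ((1*12)*(2*7)*(3*10)*(4*5)*(6*11)*(8*9))) /=.
by rewrite !subrr !addNr !addr0.
Qed.

Fact der_lie_jacobi (d e f : DerRad) :
  der_rad_lie d (der_rad_lie e f) + der_rad_lie e (der_rad_lie f d)
    + der_rad_lie f (der_rad_lie d e) = 0.
Proof.
apply: der_eqP => x; rewrite !(der_addE, der_lieE).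
rewrite (linearB (der_val d)) (linearB (der_val e)) (linearB (der_val f)) /=.
by rewrite der_lie_jacobi_aux lfunE.
Qed.

HB.instance Definition _ := Lmodule_isLie.Build K DerRad
  der_lie_linearl der_lie_linearr der_liexx der_lie_jacobi.

Definition inner_der a : 'End(A) := (amull a - amulr a)%VF.

Lemma inner_derE a x : inner_der a x = a * x - x * a.
Proof. by rewrite add_lfunE opp_lfunE !lfunE. Qed.

Lemma inner_der_rad a : inner_der a \in der_rad.
Proof.
apply/der_radP; split=> [x y|x xJ]; rewrite !inner_derE.
  by rewrite mulrBl mulrBr !mulrA addrA subrK.
by apply: rpredB; [exact: jrad_mull | exact: jrad_mulr].
Qed.

(* By inner_der_rad this is all of Inn(A), not a proper part of it. *)
Definition Inn : {pred DerRad} := fun d : DerRad => `[< exists a, inner_der a = der_val d >].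

Fact Inn_zmod_closed : zmod_closed Inn.
Proof.
split=> [|d e /asboolP[a aE] /asboolP[b bE]]; apply/asboolP.
  by exists 0; apply/lfunP => x; rewrite inner_derE mul0r mulr0 subr0 lfunE.
exists (a - b); apply/lfunP => x.
have -> : (d - e) x = d x - e x.
  by rewrite (add_lfunE (der_val d) (- der_val e)) opp_lfunE.
by rewrite -aE -bE !inner_derE mulrBl mulrBr !opprD !opprK [LHS]addrACA.
Qed.

HB.instance Definition _ :=
  GRing.isZmodClosed.Build DerRad Inn Inn_zmod_closed.

Fact Inn_scale (c : K) (d : DerRad) : d \in Inn -> c *: d \in Inn.
Proof.
move=> /asboolP[a aE]; apply/asboolP; exists (c *: a); apply/lfunP => x.
by rewrite der_scaleE -aE !inner_derE -scalerAl -scalerAr scalerBr.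
Qed.

Fact Inn_lie_aux (V : zmodType) (p q r s : V) :
  p + q - (r + s) - (q - r) = p - s.
Proof.
rewrite opprB opprD [LHS](AC ((2*2)*2) ((1*4)*(2*6)*(3*5))) /=.
by rewrite subrr addNr !addr0.
Qed.

Fact Inn_lie (d e : DerRad) : e \in Inn -> lie d e \in Inn.
Proof.
move=> /asboolP[a aE]; apply/asboolP; exists (d a); apply/lfunP => x.
have /der_radP[dD _] := valP d.
rewrite der_lieE -aE !inner_derE (linearB (der_val d)) /= !dD.
exact/esym/Inn_lie_aux.
Qed.

Definition Inn_ideal : lieIdeal DerRad := LieIdeal Inn_scale Inn_lie.

Definition HH1_rad : lieAlgType K := lie_quot Inn_ideal.

End Derivations.

Arguments HH1_rad {K} A.
Arguments jrad {K} A.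

Section RepresentationType.
Context (K : fieldType) (A : falgType K).


Record fdmod := FdMod {
  mod_sort :> vectType K;
  mod_act : 'Hom(A, 'End(mod_sort));
  mod_act1 : mod_act 1 = \1%VF;
  mod_actM : forall a b, mod_act (a * b) = (mod_act a \o mod_act b)%VF
}.

Definition mod_iso (M N : fdmod) :=
  exists f : 'Hom(M, N),
    bijective f /\ forall a v, f (mod_act M a v) = mod_act N a (f v).

Definition is_submod (M : fdmod) (U : {vspace M}) :=
  forall a v, v \in U -> mod_act M a v \in U.

Definition indecomposable (M : fdmod) :=
  (0 < \dim {:M})%N /\
  forall U W : {vspace M}, is_submod U -> is_submod W ->
    (U + W = fullv)%VS -> (U :&: W = 0)%VS -> U = 0%VS \/ W = 0%VS.

Definition finite_type :=
  exists n (N : 'I_n -> fdmod),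
    forall M, indecomposable M -> exists i, mod_iso M (N i).

(* An A-K[T]-bimodule that is free of finite rank over K[T] (with K acting
   centrally), given in a K[T]-basis: A acts on K[T]^r by matrices. *)
Record free_bimod := FreeBimod {
  bimod_rank : nat;
  bimod_act : A -> 'M[{poly K}]_bimod_rank;
  bimod_linear : forall c a b,
    bimod_act (c *: a + b) = c%:P *: bimod_act a + bimod_act b;
  bimod_act1 : bimod_act 1 = 1%:M;
  bimod_actM : forall a b, bimod_act (a * b) = bimod_act a *m bimod_act b
}.

(* The A-module B (x)_{K[T]} K[T]/(T - l): A acts on K^r by the matrices of B
   evaluated at T = l. *)
Section Specialize.
Context (B : free_bimod) (l : K).
Local Notation r := (bimod_rank B).

Definition spec_mx (a : A) : 'M[K]_r := map_mx (horner_eval l) (bimod_act B a).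

Definition spec_end (a : A) : 'End('cV[K]_r) := linfun (mulmx (spec_mx a)).

Fact spec_end_linear : linear spec_end.
Proof.
move=> c a b; apply/lfunP => v.
rewrite add_lfunE scale_lfunE !lfunE /= /spec_mx bimod_linear.
rewrite map_mxD map_mxZ /= mulmxDl -scalemxAl.
by rewrite /horner_eval hornerC.
Qed.

HB.instance Definition _ :=
  GRing.isLinear.Build K A 'End('cV[K]_r) _ spec_end spec_end_linear.

Definition spec_act : 'Hom(A, 'End('cV[K]_r)) := linfun spec_end.

Lemma spec_actE a v : spec_act a v = spec_mx a *m v.
Proof. by rewrite [spec_act a]lfunE /= lfunE. Qed.

Fact spec_act1 : spec_act 1 = \1%VF.
Proof.
apply/lfunP => v; rewrite spec_actE /spec_mx bimod_act1 map_mx1 mul1mx.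
by rewrite id_lfunE.
Qed.

Fact spec_actM a b : spec_act (a * b) = (spec_act a \o spec_act b)%VF.
Proof.
apply/lfunP => v; rewrite comp_lfunE !spec_actE.
by rewrite /spec_mx bimod_actM map_mxM mulmxA.
Qed.

Definition specialize : fdmod := FdMod spec_act1 spec_actM.

End Specialize.

Definition tame_type :=
  forall d : nat,
    exists m (B : 'I_m -> free_bimod) n (N : 'I_n -> fdmod),
      forall M, indecomposable M -> \dim {:M} = d ->
        (exists i, mod_iso M (N i)) \/
        (exists i l, mod_iso M (specialize (B i) l)).

Definition non_wild := finite_type \/ tame_type.

End RepresentationType.

Arguments non_wild {K} A.

Record quiver := Quiver {
  vertex : finType;
  arrow : finType;
  source : arrow -> vertex;
  target : arrow -> vertex
}.

(* inl i is the vertex i, and inr i the vertex i' *)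
Definition separated_quiver (Q : quiver) : quiver :=
  @Quiver (vertex Q + vertex Q)%type (arrow Q)
    (fun a => inl (source a)) (fun a => inr (target a)).

Record multigraph := Multigraph {
  node : finType;
  edge : finType;
  ends : edge -> {set node}
}.

Definition underlying_graph (Q : quiver) : multigraph :=
  @Multigraph (vertex Q) (arrow Q)
    (fun a => [set source a; target a]%SET).

Definition A1_tilde : multigraph :=
  @Multigraph bool bool (fun _ => [set: bool]%SET).

(* H is isomorphic to a (not necessarily induced) subgraph of G. *)
Definition contains_graph (G H : multigraph) :=
  exists (f : node H -> node G) (g : edge H -> edge G),
    [/\ injective f, injective g &
        forall e, ends (g e) = (f @: ends e)%SET].

Section GabrielQuiver.
Context (K : fieldType) (A : falgType K).
Implicit Types (e f : A) (U W : {vspace A}).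

Definition primitive_idempotent e :=
  [/\ e * e = e, e != 0 &
      forall f g, f * f = f -> g * g = g -> f * g = 0 -> g * f = 0 ->
        e = f + g -> f = 0 \/ g = 0].

(* A-linear isomorphism U -> W, given as the restriction to U of some h *)
Definition left_ideal_iso U W :=
  exists h : 'End(A),
    [/\ forall a x, x \in U -> h (a * x) = a * h x,
        (h @: U = W)%VS & (U :&: lker h = 0)%VS].

Definition Aidem e : {vspace A} := (fullv * <[e]>)%VS.

(* dimension of the subspace e (rad A / rad^2 A) f of rad A / rad^2 A *)
Definition dim_rad_rad2 e f :=
  (\dim (<[e]> * jrad A * <[f]> + jrad A ^+ 2)%VS - \dim (jrad A ^+ 2)%VS)%N.

(* A is not assumed basic: eps chooses one primitive idempotent for each
   isomorphism class of indecomposable projective (equivalently, of simple)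
   modules, so Q is the ordinary quiver of the basic algebra of A.  The
   opposite orientation convention yields the opposite quiver. *)
Definition is_gabriel_quiver (Q : quiver) :=
  exists eps : vertex Q -> A,
    [/\ forall i, primitive_idempotent (eps i),
        forall i j, left_ideal_iso (Aidem (eps i)) (Aidem (eps j)) -> i = j,
        forall e, primitive_idempotent e ->
          exists i, left_ideal_iso (Aidem e) (Aidem (eps i)) &
        forall i j,
          #|[pred a : arrow Q | (source a == i) && (target a == j)]|
            = dim_rad_rad2 (eps i) (eps j)].

End GabrielQuiver.

Arguments is_gabriel_quiver {K} A Q.

(* Main.v *)
From HB Require Import structures.
Require Import Defs.
From mathcomp Require Import all_boot all_order all_algebra all_field.
From mathcomp Require Import boolp classical_sets.
From mathcomp Require Import ring.

Set Implicit Arguments.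
Unset Strict Implicit.
Unset Printing Implicit Defensive.

Import GRing.Theory.
Local Open Scope ring_scope.

(** The idea is to read [HH1_rad A] off the Peirce blocks of the radical
    filtration. Write [1] as a sum of orthogonal primitive idempotents [eps s]
    and let [J] be the radical. Modulo inner derivations a derivation may be
    assumed to kill every [eps s] ([der_rad_normalize]); it then acts on each
    block [eps s * J^q * eps t / eps s * J^(q+1) * eps t]. If it acts as zero on
    all blocks with [q < 2], it moves the whole filtration one step down, and
    such derivations form a nilpotent Lie algebra because [J] is nilpotent. So
    [HH1_rad A] is solvable as soon as all these blocks are spanned by [n]
    elements and [gl_n] is solvable ([HH1_rad_solvable_of_blocks]).

    Over an algebraically closed field the blocks with [q = 0] are at most
    one-dimensional ([primitive_hom_top]), and everything rests on the blocks
    with [q = 1], whose dimensions are the numbers of arrows of the quiver.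

    If the separated quiver contains no double edge, they have dimension at most
    one, and [gl_1] is abelian; primitive idempotents of the same isomorphism
    class have the same blocks, so it is enough to look at the representatives
    that index the vertices.

    In characteristic 2 the algebra [gl_2] is solvable ([gl2_solvable]), so it is
    enough that no block contains three independent elements [x], [y], [z]. If
    one did, there would be, for every [a] and [b], an indecomposable quotient of
    [A] on which [x] acts nontrivially, [y] as [a x] and [z] as [b x]
    ([indecomposable_at_point]); these play the part of the modules of dimension
    vector (1, 1) over the 3-Kronecker quiver. Finite or tame type
    covers the plane of parameters [(a, b)] by finitely many rational curves,
    traced by the matrix entries of the actions of [x], [y] and [z] on the
    one-parameter families ([non_wild_curves]). A plane over an infinite field
    is not such a union ([curves_not_covering]). *)

(** * The radical is nilpotent *)

Section RadicalNilpotent.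
Context (K : fieldType) (A : falgType K).
Implicit Types (a x : A) (I M N U W : {vspace A}).
Local Notation J := (jrad A).

Lemma vspace_maximal (P : {vspace A} -> Prop) U : P U ->
  exists W, [/\ P W, (U <= W)%VS & forall W', P W' -> (W <= W')%VS -> W' = W].
Proof.
suff H n U0 : (\dim {:A} - \dim U0 < n)%N -> P U0 -> exists W,
    [/\ P W, (U0 <= W)%VS & forall W', P W' -> (W <= W')%VS -> W' = W].
  by move=> PU; exact: (H _ U (ltnSn _) PU).
elim: n U0 => // n IHn U0 ltU PU.
have [Umax|] := pselect (forall W', P W' -> (U0 <= W')%VS -> W' = U0).
  by exists U0; split.
move=> /existsNP[W' /not_implyP[PW' /not_implyP[UW' neqW']]].
have dimlt : (\dim U0 < \dim W')%N.
  rewrite ltn_neqAle dimvS // andbT; apply/eqP => eqd; apply: neqW'.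
  by apply/eqP; rewrite eq_sym eqEdim UW' eqd leqnn.
have [|W [PW W'W Wmax]] := IHn W' _ PW'.
  have dW' : (\dim W' <= \dim {:A})%N by rewrite dimvS // subvf.
  by rewrite -ltnS; apply: leq_trans ltU; rewrite ltnS ltn_sub2l // (leq_trans dimlt).
by exists W; split=> //; exact: subv_trans W'W.
Qed.

Lemma left_idealT M : left_ideal M -> 1 \in M -> M = fullv.
Proof.
move=> /left_idealP Ml M1; apply/eqP; rewrite eqEsubv subvf /=.
by apply/subvP => a _; rewrite -[a]mulr1 Ml.
Qed.

Lemma left_ideal_principal x : left_ideal (fullv * <[x]>)%VS.
Proof.
apply/left_idealP => a _ /memv_cosetP[b _ ->].
by rewrite mulrA memv_mul ?memvf ?memv_line.
Qed.

(** Otherwise [1 - x] would lie in a maximal left ideal, which also contains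
    [x]. *)
Lemma jrad_left_unit x : x \in J -> exists b, b * (1 - x) = 1.
Proof.
move=> xJ; have [IT|/eqP IT] := eqVneq (fullv * <[1 - x]>)%VS fullv.
  have : 1 \in (fullv * <[1 - x]>)%VS by rewrite IT memvf.
  by case/memv_cosetP => b _ bE; exists b.
have [M [[Ml MT] IM Mmax]] :=
  @vspace_maximal (fun W => left_ideal W /\ W <> fullv) _
    (conj (left_ideal_principal _) IT).
have xM : x \in M.
  move/jradP: xJ; apply; split=> //; first exact/eqP.
  move=> N Nl MN; have [NT|/eqP NT] := eqVneq N fullv; first by right.
  by left; apply: Mmax.
case: MT; apply: left_idealT => //; rewrite -(subrK x 1) rpredD //.
apply: (subvP IM); rewrite -{1}[1 - x]mul1r.
by rewrite memv_mul ?memvf ?memv_line.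
Qed.

(** For a maximal left ideal [M] without [x], a decomposition [1 = m + a * x]
    would make the left unit [1 - a * x] an element of [M]. *)
Lemma left_units_jrad x : (forall a, exists b, b * (1 - a * x) = 1) -> x \in J.
Proof.
move=> h; apply/jradP => M [Ml MT Mmax].
have Nl : left_ideal (M + fullv * <[x]>)%VS.
  apply/left_idealP => a _ /memv_addP[m mM [u ux ->]]; rewrite mulrDr memv_add //.
    exact: (left_idealP _ Ml).
  exact: (left_idealP _ (left_ideal_principal x)).
have [NM|NT] := Mmax _ Nl (addvSl _ _).
  rewrite -NM -{1}[x]mul1r; apply: (subvP (addvSr _ _)).
  by rewrite memv_mul ?memvf ?memv_line.
have : 1 \in (M + fullv * <[x]>)%VS by rewrite NT memvf.
case/memv_addP => m mM [_ /memv_cosetP[a _ ->] mE].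
have [b bE] := h a; case/eqP: MT; apply: left_idealT => //.
by rewrite -bE mE addrK (left_idealP _ Ml).
Qed.

(** Nakayama's argument: if [I'] is a maximal proper left subideal of [I] and
    [v] lies in [I] but not in [I'], then [{a | a * v \in I'}] is a maximal left
    ideal, hence contains the radical. *)
Lemma jrad_mul_proper I : left_ideal I -> I != 0%VS -> (J * I)%VS != I.
Proof.
move=> Il I0.
have [|I' [[I'l I'I I'neq] _ I'max]] :=
  @vspace_maximal (fun W => [/\ left_ideal W, (W <= I)%VS & W <> I]) 0%VS.
  split; [|exact: sub0v|by move/esym/eqP; rewrite (negPf I0)].
  by apply/left_idealP => a x; rewrite !memv0 => /eqP ->; rewrite mulr0.
suff JI : (J * I <= I')%VS.
  by apply/eqP => JIE; apply: I'neq; apply/eqP; rewrite eqEsubv I'I -{1}JIE.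
apply/prodvP => x v xJ vI; have [vI'|vI'] := boolP (v \in I').
  exact: (left_idealP _ I'l).
pose M := (amulr v @^-1: I')%VS.
have ME a : (a \in M) = (a * v \in I') by rewrite -memv_preim lfunE.
rewrite -ME; move/jradP: xJ; apply; split.
- by apply/left_idealP => a y; rewrite !ME -mulrA; exact: (left_idealP _ I'l).
- by apply: contraNneq vI' => MT; rewrite -[v]mul1r -ME MT memvf.
move=> N Nl MN.
have [NM|/subvPn[n nN nM]] := boolP (N <= M)%VS.
  by left; apply/eqP; rewrite eqEsubv NM.
right; apply: left_idealT => //.
have [W'E|W'N] := pselect ((I' + amulr v @: N)%VS = I); last first.
  suff W'E : (I' + amulr v @: N)%VS = I'.
    case/negP: nM; rewrite ME -W'E; apply: (subvP (addvSr _ _)).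
    by have := memv_img (amulr v) nN; rewrite lfunE.
  apply: I'max; last exact: addvSl.
  split=> //.
    apply/left_idealP => a _ /memv_addP[m mM [_ /memv_imgP[c cN ->] ->]].
    rewrite mulrDr memv_add ?(left_idealP _ I'l) // !lfunE /= mulrA.
    have := memv_img (amulr v) (left_idealP _ Nl a c cN); by rewrite lfunE.
  rewrite subv_add I'I /=; apply/subvP => _ /memv_imgP[c cN ->].
  by rewrite lfunE /= (left_idealP _ Il).
have : v \in (I' + amulr v @: N)%VS by rewrite W'E.
case/memv_addP => i iI' [_ /memv_imgP[c cN ->]]; rewrite lfunE /= => vE.
have cM : 1 - c \in M by rewrite ME mulrBl mul1r {1}vE addrK.
by rewrite -(subrK c 1) rpredD // (subvP MN).
Qed.

(** Powers of the radical, except that the power of exponent 0 is the whole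
    algebra rather than the line spanned by [1], so that they form a filtration
    of [A]. *)
Definition radpow n : {vspace A} := iter n (prodv J) fullv.

Lemma radpowS n : radpow n.+1 = (J * radpow n)%VS.
Proof. by []. Qed.

Lemma radpow1 : radpow 1 = J.
Proof.
apply/eqP; rewrite eqEsubv; apply/andP; split.
  by apply/prodvP => x y xJ _; exact: jrad_mulr.
by apply/subvP => x xJ; rewrite -[x]mulr1 memv_mul ?memvf.
Qed.

Lemma radpow2 : radpow 2 = (J ^+ 2)%VS.
Proof. by rewrite radpowS radpow1 expv2. Qed.

Lemma radpow_mull n a x : x \in radpow n -> a * x \in radpow n.
Proof.
case: n => [|n] xn; first exact: memvf.
apply: (left_idealP _ _ a x xn); rewrite /left_ideal radpowS prodvA prodvSl //.
by apply/prodvP => b y _ yJ; exact: jrad_mull.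
Qed.

Lemma radpow_mulr n a x : x \in radpow n -> x * a \in radpow n.
Proof.
move=> xn; suff H : (radpow n * fullv <= radpow n)%VS.
  by apply: (subvP H); rewrite memv_mul ?memvf.
elim: {x xn} n => [|n IHn]; first exact: subvf.
by rewrite radpowS -prodvA prodvSr.
Qed.

Lemma radpow_le m n : (m <= n)%N -> (radpow n <= radpow m)%VS.
Proof.
move=> /subnK <-; elim: (n - m)%N => // i IHi; rewrite addSn radpowS.
apply: subv_trans IHi; apply/prodvP => x y _; exact: radpow_mull.
Qed.

Lemma radpow_nilpotent : exists n, radpow n = 0%VS.
Proof.
suff H n : (\dim (radpow n) + n <= \dim {:A})%N \/ radpow n = 0%VS.
  have [|] := H (\dim {:A}).+1; last by exists (\dim {:A}).+1.
  by rewrite addnS ltnNge leq_addl.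
elim: n => [|n [IHn|IHn]]; first by left; rewrite addn0.
  have [|nz] := eqVneq (radpow n) 0%VS.
    by move=> n0; right; rewrite radpowS n0 prodv0.
  left; apply: leq_trans IHn; rewrite addnS -addSn leq_add2r.
  rewrite ltn_neqAle dimvS ?radpow_le // andbT.
  have nl : left_ideal (radpow n) by apply/left_idealP => a x; exact: radpow_mull.
  apply: contra (jrad_mul_proper nl nz) => eqd.
  by rewrite -radpowS eqEdim radpow_le //= (eqP eqd).
by right; rewrite radpowS IHn prodv0.
Qed.

Lemma jrad_nilp x : x \in J -> exists n, x ^+ n = 0.
Proof.
move=> xJ; have [n n0] := radpow_nilpotent; exists n; apply/eqP.
rewrite -memv0 -n0; elim: n {n0} => [|n IHn]; first exact: memvf.
by rewrite exprS memv_mul.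
Qed.

Lemma jrad_idem_eq0 e : e * e = e -> e \in J -> e = 0.
Proof.
move=> ee eJ; have [n] := jrad_nilp eJ; case: n => [/eqP|n].
  by rewrite expr0 oner_eq0.
suff -> : e ^+ n.+1 = e by [].
by elim: n => [|n IHn]; rewrite ?expr1 // exprS IHn.
Qed.

Lemma nilp_left_unit x n : x ^+ n = 0 -> exists b, b * (1 - x) = 1.
Proof.
move=> xn; exists (\sum_(i < n) x ^+ i).
have : GRing.comm (\sum_(i < n) x ^+ i) (1 - x).
  apply: commrB; first exact: commr1.
  by apply/commr_sym/commr_sum => i _; exact: commrX.
by move=> ->; rewrite -opprB mulNr -subrX1 xn sub0r opprK.
Qed.

End RadicalNilpotent.

(** * Peirce corners of primitive idempotents *)

Section PrimitiveIdempotents.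
Context (k : closedFieldType) (A : falgType k).
Implicit Types (a b e f u v w x y z : A).
Local Notation J := (jrad A).

Lemma polynomial_relation x : exists2 p : {poly k}, p != 0 & horner_alg x p = 0.
Proof.
pose X := [tuple x ^+ i | i < (\dim {:A}).+1].
have nX : ~~ free X.
  apply: contraL (leqnn (\dim {:A})) => /eqP fX; rewrite -ltnNge.
  by have := dimvS (subvf <<X>>%VS); rewrite fX size_tuple.
have [|c] := pselect (forall c : 'I_(\dim {:A}).+1 -> k,
    \sum_i c i *: X`_i = 0 -> forall i, c i = 0).
  by move/freeP; rewrite (negPf nX).
move/existsNP: c => [c /not_implyP[c0 /existsNP[i ci]]].
exists (\poly_(j < (\dim {:A}).+1) c (inord j)).
  apply/eqP => /(congr1 (fun p : {poly k} => p`_i)).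
  by rewrite coef_poly ltn_ord coef0 inord_val.
rewrite poly_def linear_sum -[RHS]c0; apply: eq_bigr => j _.
rewrite linearZ /= rmorphXn /= horner_algX inord_val.
by have -> : X`_j = x ^+ j; rewrite ?mulr_algl // -tnth_nth tnth_mktuple.
Qed.

Section OneIdempotent.
Variable e : A.
Hypothesis pe : primitive_idempotent e.

Let ee : e * e = e. Proof. by case: pe. Qed.
Let e0 : e != 0. Proof. by case: pe. Qed.

(** Let [p] annihilate [x] in the corner [e A e] and let [c] be a root of [p],
    so that [p = q * ('X - c)^m] with coprime factors. A Bezout relation splits
    [e] into two orthogonal idempotents, one of which vanishes as [e] is
    primitive: then either [q], of smaller degree, already annihilates [x], or
    ['X - c] is nilpotent at [x]. *)
Lemma primitive_nilp x : e * x = x -> x * e = x ->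
  exists c m, (x - c *: e) ^+ m.+1 = 0.
Proof.
move=> ex xe; pose h := horner_alg x.
have he p : h p * e = e * h p.
  elim/poly_ind: p => [|p c IHp]; first by rewrite /h rmorph0 mul0r mulr0.
  rewrite /h rmorphD rmorphM /= horner_algX horner_algC -/h.
  by rewrite mulrDl mulrDr mulrA -IHp -!mulrA ex xe mulr_algl mulr_algr.
have hM p q : e * h p * (e * h q) = e * h (p * q).
  by rewrite mulrA -(mulrA e) he !mulrA ee -mulrA -rmorphM.
have hXn c m : e * h (('X - c%:P) ^+ m.+1) = (x - c *: e) ^+ m.+1.
  elim: m => [|m IHm].
    by rewrite /h rmorphB /= horner_algX horner_algC mulrBr ex mulr_algr.
  rewrite [RHS]exprS -IHm [in LHS]exprS -hM; congr (_ * _).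
  by rewrite /h rmorphB /= horner_algX horner_algC mulrBr ex mulr_algr.
suff H n (p : {poly k}) : (size p <= n)%N -> p != 0 -> e * h p = 0 ->
    exists c m, (x - c *: e) ^+ m.+1 = 0.
  have [p p0 hp] := polynomial_relation x.
  by apply: (H _ p (leqnn _)) => //; rewrite /h hp mulr0.
elim: n p => [|n IHn] p sp p0 hp.
  by move: sp; rewrite leqn0 size_poly_eq0 (negPf p0).
have [/eqP/size_poly1P[c c0 pE]|/closed_rootP[c pc]] := eqVneq (size p) 1%N.
  move: hp; rewrite pE /h horner_algC mulr_algr => /eqP.
  by rewrite scaler_eq0 (negPf c0) (negPf e0).
have [[|m] [q]] := multiplicity_XsubC p c; rewrite p0 /= => qc pE.
  by move: pc; rewrite pE expr0 mulr1 (negPf qc).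
have /Bezout_eq1_coprimepP[[v u] /= uvE] : coprimep q (('X - c%:P) ^+ m.+1).
  by apply: coprimep_expr; rewrite coprimep_XsubC.
set r := ('X - c%:P) ^+ m.+1 in pE uvE.
have sumE : e * h (v * q) + e * h (u * r) = e.
  by rewrite -mulrDr -rmorphD uvE rmorph1 mulr1.
have prod0 s t : e * h (s * (q * r) * t) = 0.
  by rewrite -pE -!hM hp mulr0 mul0r.
have fg : e * h (v * q) * (e * h (u * r)) = 0.
  rewrite hM -(prod0 v u); congr (e * h _).
  by rewrite -!mulrA; congr (_ * (_ * _)); rewrite mulrC.
have gf : e * h (u * r) * (e * h (v * q)) = 0.
  by rewrite -fg hM [RHS]hM mulrC.
have fe s : e * h s * e = e * h s by rewrite -mulrA he mulrA ee.
have ff : e * h (v * q) * (e * h (v * q)) = e * h (v * q).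
  by rewrite -[RHS]fe -[X in _ = _ * X]sumE mulrDr fg addr0.
have gg : e * h (u * r) * (e * h (u * r)) = e * h (u * r).
  by rewrite -[RHS]fe -[X in _ = _ * X]sumE mulrDr gf add0r.
have [_ _ /(_ _ _ ff gg fg gf (esym sumE))[f0|g0]] := pe.
  apply: (IHn q).
  - rewrite -ltnS; apply: leq_trans sp; rewrite pE size_Mmonic ?monic_exp ?monicXsubC //.
      rewrite size_exp_XsubC addnS /= -[X in (X < _)%N]addn0 ltn_add2l //.
    by apply: contraNneq p0 => q0; rewrite pE q0 mul0r.
  - by apply: contraNneq p0 => q0; rewrite pE q0 mul0r.
  rewrite -[e * h q]fe -[X in _ * X]sumE f0 add0r hM.
  have -> : q * (u * r) = 1 * (q * r) * u by rewrite mul1r -mulrA [u * r]mulrC.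
  exact: prod0.
exists c, m; rewrite -hXn -/r -[e * h r]fe -[X in _ * X]sumE g0 addr0 hM.
have -> : r * (v * q) = 1 * (q * r) * v by rewrite mul1r [RHS]mulrC [RHS]mulrA [RHS]mulrC.
exact: prod0.
Qed.

(** A nilpotent [y] of the corner generates a nil left ideal: were
    [e * a * y = c *: e + nilpotent] with [c != 0], it would be a unit of the
    corner, although it is a left multiple of the nilpotent [y]. *)
Lemma corner_nilp_jrad y m : e * y = y -> y * e = y -> y ^+ m = 0 -> y \in J.
Proof.
move=> ey ye ym0; apply: left_units_jrad => a.
suff [n eayn] : exists n, (e * a * y) ^+ n = 0.
  apply: (@nilp_left_unit _ _ _ n.+1); rewrite -[RHS](mulr0 (a * y)) -eayn.
  elim: {eayn} n => [|n IHn]; first by rewrite expr1 expr0 mulr1.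
  rewrite exprSr IHn [in RHS]exprSr; case: n {IHn} => [|n].
    by rewrite !expr0 mulr1 mul1r !mulrA -(mulrA _ y e) ye.
  by rewrite exprSr !mulrA -(mulrA _ y e) ye.
have [||c [n zn]] := @primitive_nilp (e * a * y).
- by rewrite !mulrA ee.
- by rewrite -mulrA ye.
have [c0|c0] := eqVneq c 0; first by exists n.+1; rewrite c0 scale0r subr0 in zn.
have [|b bE] := @nilp_left_unit _ _ (- c^-1 *: (e * a * y - c *: e)) n.+1.
  by rewrite exprZn zn scaler0.
have {}bE : b * (e * a * y) = c *: e.
  have -> : e * a * y = c *: ((1 - (- c^-1 *: (e * a * y - c *: e))) * e).
    rewrite mulrBl mul1r -scalerAl mulrBl -scalerAl ee -(mulrA _ y e) ye.
    rewrite scaleNr opprK scalerBr scalerA mulVf // scale1r addrC subrK.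
    by rewrite scalerA divff // scale1r.
  by rewrite -scalerAr mulrA bE mul1r.
exfalso; elim: m ym0 => [|m IHm] ym0.
  by move/eqP: ym0; rewrite expr0 oner_eq0.
apply: IHm; have : c *: (e * y ^+ m) = 0.
  by rewrite scalerAl -bE -!mulrA -exprS ym0 !mulr0.
move/eqP; rewrite scaler_eq0 (negPf c0) /=; case: m {ym0} => [|m] /eqP.
  by rewrite expr0 mulr1 => /eqP; rewrite (negPf e0).
by rewrite exprS mulrA ey.
Qed.

Lemma primitive_corner x : exists c, e * x * e - c *: e \in J.
Proof.
have [||c [m xm]] := @primitive_nilp (e * x * e).
- by rewrite !mulrA ee.
- by rewrite -mulrA ee.
exists c; apply: corner_nilp_jrad xm.
- by rewrite mulrBr -scalerAr !mulrA ee.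
- by rewrite mulrBl -scalerAl -!mulrA ee.
Qed.

Lemma primitive_notin_jrad : e \notin J.
Proof. by apply: contra e0 => eJ; rewrite (jrad_idem_eq0 ee eJ). Qed.

Lemma scale_primitive_jrad c : c *: e \in J -> c = 0.
Proof.
move=> ceJ; apply: contraNeq primitive_notin_jrad => c0.
by rewrite -[e](scalerKV c0) scalerA mulrC -scalerA rpredZ.
Qed.

End OneIdempotent.

(** If all the products [e * u * f * v * e] lay in the radical, the left ideal
    generated by [e * u * f] would consist of elements with square in the
    radical, hence nilpotent, and [e * u * f] would lie in the radical. Otherwise
    some [e * u * f * v * e] is, modulo the radical, a nonzero multiple of [e];
    then so is [f * v * e * u * f] of [f], and multiplying [e * x * f] by it on
    the right compares [e * x * f] with [e * u * f]. *)
Lemma primitive_hom_top e f : primitive_idempotent e -> primitive_idempotent f ->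
  exists u, forall x, exists c, e * x * f - c *: (e * u * f) \in J.
Proof.
move=> pe pf; have [[ee e0 _] [ff f0 _]] := (pe, pf).
have [allJ|] := pselect (forall x, e * x * f \in J).
  by exists 0 => x; exists 0; rewrite scale0r subr0.
move=> /existsNP[u /negP uJ]; exists u.
have [vJ|] := pselect (forall v, e * u * f * v * e \in J).
  case/negP: uJ; apply: left_units_jrad => a; set y := a * _.
  have yyJ : y * y \in J.
    have -> : y * y = a * (e * u * f * (f * a) * e) * (u * f).
      by rewrite /y !mulrA -(mulrA _ f f) ff.
    exact/jrad_mulr/jrad_mull/vJ.
  have [n yn] := jrad_nilp yyJ; apply: (@nilp_left_unit _ _ _ (2 * n)).
  by rewrite exprM expr2.
move=> /existsNP[v /negP uvJ] x.
have [c cE] := primitive_corner pe (u * f * v).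
have c0 : c != 0.
  apply: contraNneq uvJ => c0; move: cE.
  by rewrite c0 scale0r subr0 !mulrA.
have [c' c'E] := primitive_corner pf (v * e * u).
have [d dE] := primitive_corner pe (x * f * v).
(* [c' = 0] would put the square of [e * u * f * v * e] in the radical, but it
   is congruent to [c ^+ 2 *: e]. *)
have c'0 : c' != 0.
  have : (e * u * f * v * e) * (e * u * f * v * e) \notin J.
    apply/negP => sqJ.
    have : c ^+ 2 *: e \in J.
      rewrite -[_ *: _](subrK ((e * u * f * v * e) * (e * u * f * v * e))) rpredD //.
      rewrite -rpredN opprB expr2.
      have -> : e * u * f * v * e * (e * u * f * v * e) - (c * c) *: e =
        (e * (u * f * v) * e - c *: e) * (e * u * f * v * e)
        + (c *: e) * (e * (u * f * v) * e - c *: e).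
        by rewrite mulrBl mulrBr !mulrA addrA subrK -!scalerAr -!scalerAl ee scalerA.
      by apply: rpredD; [exact: jrad_mulr | exact: jrad_mull].
    by move/(scale_primitive_jrad pe)/eqP; rewrite expf_eq0 (negPf c0).
  apply: contraNneq => c'0; move: c'E; rewrite c'0 scale0r subr0 => H.
  have -> : e * u * f * v * e * (e * u * f * v * e)
     = e * u * (f * (v * e * u) * f) * v * e.
    by rewrite !mulrA -(mulrA _ e e) ee.
  exact/jrad_mulr/jrad_mulr/jrad_mull.
exists (c'^-1 * d).
have -> : e * x * f - (c'^-1 * d) *: (e * u * f) =
   c'^-1 *: ((e * (x * f * v) * e - d *: e) * (u * f)
             - e * x * (f * (v * e * u) * f - c' *: f)).
  have -> : (e * (x * f * v) * e - d *: e) * (u * f)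
      - e * x * (f * (v * e * u) * f - c' *: f)
      = c' *: (e * x * f) - d *: (e * u * f).
    rewrite mulrBl mulrBr -!scalerAl -scalerAr !mulrA opprB.
    by rewrite addrC addrA subrK.
  by rewrite scalerBr !scalerA mulVf // scale1r.
by apply/rpredZ/rpredB; [exact: jrad_mulr | exact: jrad_mull].
Qed.

End PrimitiveIdempotents.

(** * Decomposing and comparing idempotents *)

Section IdempotentDecomposition.
Context (K : fieldType) (A : falgType K).
Implicit Types (a e f g p q x : A).
Local Notation J := (jrad A).

(** A splitting [e = x + y] into nonzero orthogonal idempotents strictly
    decreases the dimension of the left ideal [A e]. *)
Lemma idempotent_decomposition e : e * e = e ->
  exists (I : finType) (eps : I -> A),
    [/\ forall i, primitive_idempotent (eps i),
        forall i, e * eps i = eps i /\ eps i * e = eps i,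
        forall i j, i != j -> eps i * eps j = 0 &
        \sum_i eps i = e].
Proof.
have [n] := ubnP (\dim (Aidem e)); elim: n e => // n IHn e len ee.
have [->|e0] := eqVneq e 0.
  exists 'I_0, (fun=> 0); split=> [[]|[]|[]|]//.
  by rewrite big_ord0.
have [pe|] := pselect (primitive_idempotent e).
  exists unit, (fun=> e); split=> //.
  by rewrite (big_pred1 tt) // => -[].
move=> npe; have [f [g [ff gg fg gf [eE f0 g0]]]] : exists f g,
    [/\ f * f = f, g * g = g, f * g = 0, g * f = 0 & [/\ e = f + g, f <> 0 & g <> 0]].
  apply: contrapT => H; apply: npe; split=> // f g ff gg fg gf eE.
  have [->|/eqP f0] := eqVneq f 0; first by left.
  have [->|/eqP g0] := eqVneq g 0; first by right.
  by case: H; exists f, g.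
have smaller x y : x * x = x -> y * y = y -> x * y = 0 -> y * x = 0 -> e = x + y ->
    y <> 0 -> (\dim (Aidem x) < n)%N.
  move=> xx yy xy yx xyE y0; rewrite -ltnS; apply: leq_trans len.
  rewrite ltnS ltn_neqAle; apply/andP; split; last first.
    apply/dimvS/subvP => _ /memv_cosetP[a _ ->].
    have -> : a * x = a * x * e by rewrite xyE -mulrA mulrDr xx xy addr0.
    by rewrite memv_mul ?memvf ?memv_line.
  apply/eqP => eqd; apply: y0.
  have /eqP AE : (Aidem x == Aidem e)%VS.
    rewrite eqEdim eqd leqnn andbT; apply/subvP => _ /memv_cosetP[a _ ->].
    have -> : a * x = a * x * e by rewrite xyE -mulrA mulrDr xx xy addr0.
    by rewrite memv_mul ?memvf ?memv_line.
  have : y \in Aidem x.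
    have yE : y = y * e by rewrite xyE mulrDr yx yy add0r.
    by rewrite AE yE memv_mul ?memvf ?memv_line.
  by case/memv_cosetP => a _ yE; rewrite yE -xx mulrA -yE yx.
have [I1 [eps1 [prim1 in1 orth1 sum1]]] := IHn f (smaller _ _ ff gg fg gf eE g0) ff.
have [I2 [eps2 [prim2 in2 orth2 sum2]]] :=
  IHn g (smaller _ _ gg ff gf fg (etrans eE (addrC _ _)) f0) gg.
exists (I1 + I2)%type, (fun i => match i with inl i => eps1 i | inr i => eps2 i end).
split.
- by case.
- case=> i; rewrite eE mulrDl mulrDr.
    have [fi jf] := in1 i; have gi : g * eps1 i = 0 by rewrite -fi mulrA gf mul0r.
    have ig : eps1 i * g = 0 by rewrite -jf -mulrA fg mulr0.
    by rewrite fi jf gi ig !addr0.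
  have [gi ig] := in2 i; have fi : f * eps2 i = 0 by rewrite -gi mulrA fg mul0r.
  have jf : eps2 i * f = 0 by rewrite -ig -mulrA gf mulr0.
  by rewrite gi ig fi jf !add0r.
- case=> i [] j neq; first exact: orth1.
  + by rewrite -(proj2 (in1 i)) -(proj1 (in2 j)) mulrA -(mulrA _ f) fg mulr0 mul0r.
  + by rewrite -(proj2 (in2 i)) -(proj1 (in1 j)) mulrA -(mulrA _ g) gf mulr0 mul0r.
  + exact: orth2.
by rewrite big_sumType /= sum1 sum2 eE.
Qed.

(** The isomorphism is right multiplication by its value [p] at [e], and its
    inverse is right multiplication by an element [q]. *)
Lemma left_ideal_iso_idem e f : e * e = e -> f * f = f ->
  left_ideal_iso (Aidem e) (Aidem f) ->
  exists p q, [/\ p * q = e, q * p = f, e * p * f = p & f * q * e = q].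
Proof.
move=> ee ff [h [hM hE kerh]].
have memA a x : a * x \in Aidem x by rewrite memv_mul ?memvf ?memv_line.
have inA x : x * x = x -> x \in Aidem x by move=> xx; rewrite -{1}xx memA.
have hinj x : x \in Aidem e -> h x = 0 -> x = 0.
  by move=> xe hx; apply/eqP; rewrite -memv0 -kerh memv_cap xe memv_ker hx /=.
pose p := h e; have ep : e * p = p by rewrite -hM ?ee ?inA.
have pf : p * f = p.
  have : p \in Aidem f by rewrite -hE memv_img ?inA.
  by case/memv_cosetP => a _ ->; rewrite -mulrA ff.
have [v vA hv] : exists2 v, v \in Aidem e & h v = f.
  have : f \in (h @: Aidem e)%VS by rewrite hE inA.
  by case/memv_imgP => v vA ->; exists v.
have ve : v * e = v by case/memv_cosetP: vA => a _ ->; rewrite -mulrA ee.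
have vp : v * p = f by rewrite -hM ?inA // ve hv.
exists p, (f * v); split.
- apply/eqP; rewrite -subr_eq0; apply/eqP/hinj.
    by rewrite rpredB ?inA // -ve !mulrA memA.
  by rewrite linearB /= -{1}ve !mulrA hM ?inA // -!mulrA vp ff pf subrr.
- by rewrite -mulrA vp ff.
- by rewrite ep pf.
by rewrite mulrA ff -mulrA ve.
Qed.

End IdempotentDecomposition.

(** * Solvability along descending chains; solvable matrix algebras *)

Section LieChains.
Context (K : comNzRingType).

Lemma is_subspace_setT (L : lieAlgType K) : is_subspace [set: L].
Proof. by []. Qed.

Lemma is_subspace0 (L : lieAlgType K) : is_subspace [set (0 : L)].
Proof. by split=> // c x y -> ->; rewrite scaler0 addr0. Qed.

Lemma derived_series_subspace (L : lieAlgType K) n : is_subspace (@derived_series K L n).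
Proof.
case: n => [|n]; first exact: is_subspace_setT.
split=> [|c x y xD yD] U [Usub HU]; first by case: Usub.
by apply: (proj2 Usub); [apply: xD | apply: yD].
Qed.

Lemma derived_series_lie (L : lieAlgType K) n (x y : L) :
  derived_series n x -> derived_series n y -> derived_series n.+1 (lie x y).
Proof. by move=> xD yD U [_ HU]; apply: HU; exists x => //; exists y. Qed.

Lemma derived_series_le (L : lieAlgType K) m n (x : L) :
  (m <= n)%N -> derived_series n x -> derived_series m x.
Proof.
move=> /subnK <-; elim: (n - m)%N x => // i IHi x; rewrite addSn => xD.
apply: IHi; have decr j : (derived_series j.+1 `<=` @derived_series K L j)%classic.
  elim: j => [|j IHj] y yD //; apply: yD; split; first exact: derived_series_subspace.
  by move=> _ [a aD [b bD <-]]; apply: derived_series_lie; exact: IHj.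
exact: decr.
Qed.

(** Solvability of [L / I] can be read off any descending sequence of subspaces
    of [L] that behaves like the derived series and whose first term covers
    [L / I]; the first term need not be all of [L]. *)
Lemma lie_quot_solvable (L : lieAlgType K) (I : lieIdeal L)
    (C : nat -> set L) (N : nat) :
  (forall n, is_subspace (C n)) ->
  (forall n x y, C n x -> C n y -> C n.+1 (lie x y)) ->
  (forall x, exists2 y, C 0%N y & x - y \in I) ->
  (C N `<=` [set 0])%classic ->
  lie_solvable (lie_quot I).
Proof.
move=> Csub Clie Ccover CN.
pose pi (x : L) : lie_quot I := (\pi_(lie_quot I) x)%qT.
have piD c x y : pi (c *: x + y) = c *: pi x + pi y.
  rewrite /pi (Quotient.pi_add (lie_ideal_pred I)); congr (_ + _).
  exact/esym/pi_scale.
have pi0 : pi 0 = 0 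
  by apply: (addrI (1 *: pi 0)); rewrite -piD scaler0 !addr0 scale1r.
have sub n : (derived_series n `<=` pi @` C n)%classic.
  elim: n => [|n IHn] q.
    move=> _; have [y yC xy] := Ccover (repr q); exists y => //.
    by rewrite /pi -(eq_pi xy) reprK.
  apply; split.
    split; first by exists 0; [case: (Csub n.+1)|exact: pi0].
    move=> c _ _ [x xC <-] [y yC <-]; exists (c *: x + y); last exact: piD.
    exact: (proj2 (Csub n.+1)).
  move=> _ [p /IHn[x xC <-] [r /IHn[y yC <-] <-]]; exists (lie x y); first exact: Clie.
  exact/esym/pi_lie.
exists N; apply/seteqP; split=> [q /sub[x /CN -> <-]//|_ ->].
exact: (proj1 (derived_series_subspace _ _)).
Qed.

Lemma lie_solvable_chain (L : lieAlgType K) (C : nat -> set L) (N : nat) :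
  (forall n, is_subspace (C n)) ->
  (forall n x y, C n x -> C n y -> C n.+1 (lie x y)) ->
  (forall x, C 0%N x) -> (C N `<=` [set 0])%classic -> lie_solvable L.
Proof.
move=> Csub Clie CT CN; exists N.
have sub n : (derived_series n `<=` C n)%classic.
  elim: n => [|n IHn] x; first by move=> _; exact: CT.
  apply; split; first exact: Csub.
  by move=> _ [a /IHn aC [b /IHn bC <-]]; exact: Clie.
apply/seteqP; split=> [x /sub/CN//|_ ->].
exact: (proj1 (derived_series_subspace _ _)).
Qed.

End LieChains.

Section GeneralLinear.
Context (K : comNzRingType) (n : nat).
Implicit Types (x y z : 'M[K]_n).

Definition mx_lie x y := x *m y - y *m x.

Fact mx_lie_linearl (c : K) x y z : mx_lie (c *: x + y) z = c *: mx_lie x z + mx_lie y z.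
Proof.
by rewrite /mx_lie mulmxDl mulmxDr -scalemxAl -scalemxAr scalerBr opprD addrACA.
Qed.

Fact mx_lie_linearr (c : K) x y z : mx_lie z (c *: x + y) = c *: mx_lie z x + mx_lie z y.
Proof.
by rewrite /mx_lie mulmxDl mulmxDr -scalemxAl -scalemxAr scalerBr opprD addrACA.
Qed.

Fact mx_liexx x : mx_lie x x = 0.
Proof. exact: subrr. Qed.

Fact mx_lie_jacobi x y z :
  mx_lie x (mx_lie y z) + mx_lie y (mx_lie z x) + mx_lie z (mx_lie x y) = 0.
Proof.
rewrite /mx_lie !(mulmxBl, mulmxBr) !mulmxA; exact: der_lie_jacobi_aux.
Qed.

HB.instance Definition _ := Lmodule_isLie.Build K 'M[K]_n
  mx_lie_linearl mx_lie_linearr mx_liexx mx_lie_jacobi.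

End GeneralLinear.

Section SolvableGL.
Context (K : fieldType).

Lemma gl1_solvable : lie_solvable 'M[K]_1.
Proof.
apply: (@lie_solvable_chain _ _ (fun n => if n is 0 then setT else [set 0]%classic) 1) => //.
  by case=> [|n]; [exact: is_subspace_setT | exact: is_subspace0].
move=> n x y _ _; rewrite /lie /= /mx_lie [x]mx11_scalar [y]mx11_scalar.
by rewrite -!scalar_mxM mulrC subrr.
Qed.

Lemma mx2P (x y : 'M[K]_2) : x 0 0 = y 0 0 -> x 0 1 = y 0 1 -> x 1 0 = y 1 0 ->
  x 1 1 = y 1 1 -> x = y.
Proof.
move=> e00 e01 e10 e11; apply/matrixP => i j.
by case: (unliftP 0 i) => [i'|] ->; case: (unliftP 0 j) => [j'|] ->;
  rewrite ?(ord1 i') ?(ord1 j') //;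
  have -> : lift 0 0 = 1 :> 'I_2 by apply/val_inj.
Qed.

(** The first derived algebra is in [sl_2]. With the usual basis [e], [f], [h] of
    [sl_2], the brackets of [h] with [e] and [f] are multiples of 2, so that only
    [[e, f] = h] survives, and [h] is the identity matrix in characteristic 2. *)
Lemma gl2_solvable : 2%N \in [pchar K] -> lie_solvable 'M[K]_2.
Proof.
move=> /andP[_ /eqP two0].
pose C n : set 'M[K]_2 := (match n with
  | 0 => setT | 1 => [set x | \tr x = 0] | 2 => [set x | exists c, x = c%:M]
  | _ => [set 0] end)%classic.
apply: (@lie_solvable_chain _ _ C 3) => //.
  case=> [|[|[|n]]]; [exact: is_subspace_setT | | | exact: is_subspace0].
    split=> [|c x y]; first exact: mxtrace0.
    by rewrite /C /= mxtraceD mxtraceZ => -> ->; rewrite mulr0 addr0.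
  split=> [|c _ _ [a ->] [b ->]]; first by exists 0; rewrite raddf0.
  by exists (c * a + b); rewrite scale_scalar_mx -raddfD.
case=> [|[|n]] x y xC yC; rewrite /lie /= /mx_lie.
- by rewrite /C /= raddfB /= mxtrace_mulC subrr.
- have tr z : C 1%N z -> z 1 1 = z 0 0.
    rewrite /C /= /mxtrace big_ord_recl big_ord1 => /eqP.
    have -> : lift ord0 ord0 = 1 :> 'I_2 by apply/val_inj.
    rewrite addrC addr_eq0 => /eqP ->; apply/eqP; rewrite eq_sym -addr_eq0.
    by rewrite -mulr2n -mulr_natr two0 mulr0.
  have mE (u v : 'M[K]_2) i j : (u *m v) i j = u i 0 * v 0 j + u i 1 * v 1 j.
    rewrite mxE big_ord_recl big_ord1.
    by have -> : lift ord0 ord0 = 1 :> 'I_2 by apply/val_inj.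
  exists (x 0 1 * y 1 0 - y 0 1 * x 1 0); apply: mx2P;
    rewrite [LHS]mxE [X in _ + X]mxE !mE ?(tr x xC) ?(tr y yC) [RHS]mxE /= ?mulr1n ?mulr0n.
  + ring.
  + ring.
  + ring.
  apply/eqP; rewrite -subr_eq0; apply/eqP.
  have -> : x 1 0 * y 0 1 + x 0 0 * y 0 0 - (y 1 0 * x 0 1 + y 0 0 * x 0 0)
     - (x 0 1 * y 1 0 - y 0 1 * x 1 0) = 2%:R * (x 1 0 * y 0 1 - x 0 1 * y 1 0) by ring.
  by rewrite two0 mul0r.
have [a [b [-> ->]]] : exists a b, x = a%:M /\ y = b%:M.
  case: n xC yC => [|n] /= xC yC; last by exists 0, 0; rewrite xC yC raddf0.
  by case: xC yC => [a ->] [b ->]; exists a, b.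
by rewrite /C /= -!scalar_mxM mulrC subrr.
Qed.

End SolvableGL.

(** * Derivations acting on Peirce blocks *)

Section BlockRepresentation.
Context (K : fieldType) (A : falgType K) (n : nat).
Implicit Types (d : 'End(A)) (us : 'I_n -> A) (V W : {vspace A}).
Local Notation J := (jrad A).

Definition lincomb us (r : 'rV[K]_n) : A := \sum_i r 0 i *: us i.

Lemma lincomb_linear us c r s : lincomb us (c *: r + s) = c *: lincomb us r + lincomb us s.
Proof.
rewrite /lincomb scaler_sumr -big_split /=; apply: eq_bigr => i _.
by rewrite !mxE scalerDl scalerA.
Qed.

Lemma lincombB us r s : lincomb us (r - s) = lincomb us r - lincomb us s.
Proof. by rewrite addrC -scaleN1r lincomb_linear scaleN1r addrC. Qed.

Lemma lincomb_mul us r (m : 'M[K]_n) :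
  lincomb us (r *m m) = \sum_i r 0 i *: lincomb us (row i m).
Proof.
have lin_sum (I : finType) (F : I -> 'rV_n) :
    lincomb us (\sum_i F i) = \sum_i lincomb us (F i).
  apply: (big_morph _ (id1 := 0) (op1 := +%R)) => [x y|].
    by rewrite -[x in LHS]scale1r lincomb_linear scale1r.
  by rewrite /lincomb big1 // => i _; rewrite mxE scale0r.
rewrite mulmx_sum_row lin_sum; apply: eq_bigr => i _.
have lincomb0 : lincomb us 0 = 0 by rewrite -(subrr 0) lincombB subrr.
by rewrite -[_ *: _]addr0 lincomb_linear lincomb0 addr0.
Qed.

(** The [us i] generate [e V f] modulo [W]. Linear independence is not asked
    for: a block of smaller dimension is spanned with repetitions, so that one
    [n] serves for all the blocks. *)
Definition spans_block e f V W us :=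
  (forall i, us i \in V /\ e * us i * f = us i) /\
  forall x, x \in V -> exists r, e * x * f - lincomb us r \in W.

(** A relation rather than a function from [d] to [m]: when the [us i] are
    dependent modulo [W], several matrices represent the same [d]. Row vectors
    make composition reverse the order of the matrices. *)
Definition represents us W d (m : 'M[K]_n) :=
  forall r, d (lincomb us r) - lincomb us (r *m m) \in W.

Lemma represents_linear us W c d1 d2 m1 m2 :
  represents us W d1 m1 -> represents us W d2 m2 ->
  represents us W (c *: d1 + d2) (c *: m1 + m2).
Proof.
move=> h1 h2 r; rewrite add_lfunE scale_lfunE mulmxDr -scalemxAr lincomb_linear.
rewrite opprD addrACA -scalerBr rpredD ?rpredZ ?h1 ?h2 //.
Qed.

Lemma represents_comp us W d1 d2 m1 m2 : (forall x, x \in W -> d1 x \in W) ->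
  represents us W d1 m1 -> represents us W d2 m2 ->
  represents us W (d1 \o d2)%VF (m2 *m m1).
Proof.
move=> W1 h1 h2 r; rewrite comp_lfunE mulmxA.
rewrite -(subrK (d1 (lincomb us (r *m m2))) (d1 _)) -linearB /= -addrA.
by rewrite rpredD ?W1 ?h1 ?h2.
Qed.

Lemma represents_exists e f V W us d :
  (forall x, x \in V -> d x \in V) -> (forall x, d (e * x * f) = e * d x * f) ->
  spans_block e f V W us -> exists m, represents us W d m.
Proof.
move=> dV dE [usV span].
have /choice[R RE] : forall i, exists r, d (us i) - lincomb us r \in W.
  move=> i; have [uV uE] := usV i; have [r rE] := span _ (dV _ uV).
  by exists r; rewrite -uE dE.
exists (\matrix_i R i) => r; rewrite lincomb_mul /lincomb linear_sum -sumrB.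
apply: rpred_sum => i _; rewrite linearZ /= -scalerBr rpredZ //.
by rewrite rowK RE.
Qed.

Lemma represents0_block e f V W us d : (forall x, x \in W -> d x \in W) ->
  spans_block e f V W us -> represents us W d 0 ->
  forall x, x \in V -> d (e * x * f) \in W.
Proof.
move=> dW [_ span] rep0 x xV; have [r rE] := span _ xV.
rewrite -(subrK (lincomb us r) (e * x * f)) linearD /=.
apply: rpredD; first exact: dW.
have := rep0 r; rewrite mulmx0 /lincomb [X in _ - X]big1 ?subr0 //.
by move=> i _; rewrite mxE scale0r.
Qed.

End BlockRepresentation.

Section SolvableCriterion.
Context (K : fieldType) (A : falgType K).
Variables (I : finType) (eps : I -> A) (n : nat).
Hypothesis eps_idem : forall i, eps i * eps i = eps i.
Hypothesis eps_orth : forall i j, i != j -> eps i * eps j = 0.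
Hypothesis eps_sum : \sum_i eps i = 1.
Local Notation J := (jrad A).

Lemma peirce_sum (x : A) : x = \sum_i \sum_j eps i * x * eps j.
Proof.
rewrite -[LHS]mul1r -eps_sum mulr_suml; apply: eq_bigr => i _.
by rewrite -mulr_sumr eps_sum mulr1.
Qed.

Lemma der_rad_radpow (d : DerRad A) i x : x \in radpow A i -> d x \in radpow A i.
Proof.
have /der_radP[dD dJ] := valP d.
elim: i x => [|i IHi] x; first by move=> _; exact: memvf.
rewrite radpowS => xi; suff /subvP dS : (J * radpow A i <= der_val d @^-1: radpow A i.+1)%VS.
  by have := dS _ xi; rewrite -memv_preim.
apply/prodvP => y z yJ zi; rewrite -memv_preim dD rpredD //.
  by rewrite memv_mul ?dJ.
by rewrite memv_mul ?IHi.
Qed.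

(** By the Leibniz rule, as all further layers are products of elements of [J]. *)
Lemma der_rad_radpowS (d : DerRad A) :
  (forall q x, (q < 2)%N -> x \in radpow A q -> d x \in radpow A q.+1) ->
  forall i x, x \in radpow A i -> d x \in radpow A i.+1.
Proof.
move=> d01; have /der_radP[dD dJ] := valP d.
elim=> [|i IHi] x xi; first exact: d01.
suff /subvP dS : (J * radpow A i <= der_val d @^-1: radpow A i.+2)%VS.
  by have := dS _ xi; rewrite -memv_preim.
apply/prodvP => y z yJ zi; rewrite -memv_preim dD rpredD //; last first.
  by rewrite radpowS memv_mul ?IHi.
have : d y \in radpow A 2 by apply: d01 => //; rewrite radpow1.
rewrite radpowS radpow1 => dy.
by rewrite !radpowS prodvA memv_mul.
Qed.

(** The inner derivation of [\sum_i d (eps i) * eps i] agrees with [d] on every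
    [eps t]: differentiate [eps t * eps s = 0] and [eps t * eps t = eps t]. *)
Lemma der_rad_normalize (d : DerRad A) :
  exists2 d' : DerRad A, (forall i, d' (eps i) = 0) & d - d' \in Inn_ideal A.
Proof.
have /der_radP[dD dJ] := valP d.
pose a := \sum_i d (eps i) * eps i; pose b := MkDerRad (inner_der_rad a).
exists (d - b); last first.
  by rewrite opprB addrC subrK; apply/asboolP; exists a.
move=> t.
have -> : (d - b) (eps t) = d (eps t) - inner_der a (eps t).
  by rewrite (add_lfunE (der_val d) (- der_val b)) opp_lfunE.
apply/eqP; rewrite subr_eq0 inner_derE; apply/eqP.
have at_ : a * eps t = d (eps t) * eps t.
  rewrite mulr_suml (bigD1 t) //= -mulrA eps_idem big1 ?addr0 // => s st.
  by rewrite -mulrA eps_orth ?mulr0.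
have ta : eps t * a = d (eps t) * eps t - d (eps t).
  rewrite -[X in _ = _ - X]mulr1 -eps_sum !mulr_sumr (bigD1 t) //=.
  rewrite [in RHS](bigD1 t) //= opprD addrA subrr add0r.
  have -> : eps t * (d (eps t) * eps t) = 0.
    have := congr1 (fun x => x * eps t) (dD (eps t) (eps t)).
    rewrite eps_idem mulrDl -!mulrA eps_idem => /eqP.
    by rewrite -subr_eq0 opprD addrA subrr add0r oppr_eq0 => /eqP.
  rewrite add0r -sumrN; apply: eq_bigr => s st.
  have := congr1 (fun x => x * eps s) (dD (eps t) (eps s)).
  rewrite eps_orth 1?eq_sym // linear0 mul0r mulrDl -!mulrA eps_idem => /esym/eqP.
  by rewrite addrC addr_eq0 => /eqP.
by rewrite at_ ta opprB addrC subrK.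
Qed.

Hypothesis gl_solvable : lie_solvable 'M[K]_n.
Hypothesis blocks : forall q s t, (q < 2)%N ->
  exists us : 'I_n -> A, spans_block (eps s) (eps t) (radpow A q) (radpow A q.+1) us.

(** The chain of derivations that witnesses solvability has two regimes. As
    long as [j < N], the representing matrices on the blocks descend the derived
    series of [gl_n]; at stage [N] they vanish, so the derivations lower the
    radical filtration, and each further bracket lowers it by one more step. *)
Lemma HH1_rad_solvable_of_blocks : lie_solvable (HH1_rad A).
Proof.
have [N glN] := gl_solvable; have [M radM] := radpow_nilpotent A.
have /choice[us usE] : forall z : nat * I * I, exists us : 'I_n -> A, (z.1.1 < 2)%N ->
    spans_block (eps z.1.2) (eps z.2) (radpow A z.1.1) (radpow A z.1.1.+1) us.
  move=> [[q s] t] /=; have [q2|_] := boolP (q < 2)%N; last by exists (fun=> 0).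
  by have [us usE] := @blocks q s t q2; exists us.
have ders := @derived_series_subspace K 'M[K]_n.
(* The truncated difference is 0 in the first regime. *)
pose C j : set (DerRad A) := fun d =>
  [/\ forall i, d (eps i) = 0,
      forall q s t, (q < 2)%N -> exists2 m : 'M[K]_n, derived_series j m &
        represents (us (q, s, t)) (radpow A q.+1) d m &
      forall i x, x \in radpow A i -> d x \in radpow A (i + (j - N))].
have scaleE c (d : DerRad A) x : (c *: d) x = c *: d x.
  exact: (scale_lfunE c (der_val d)).
have addE (d d' : DerRad A) x : (d + d') x = d x + d' x.
  exact: (add_lfunE (der_val d) (der_val d')).
have lieE (d d' : DerRad A) x : lie d d' x = d (d' x) - d' (d x) by exact: commE.
apply: (@lie_quot_solvable _ _ (Inn_ideal A) C (N + M)).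
- move=> j; split.
    split=> [i|q s t q2|i x _]; rewrite ?lfunE ?rpred0 //.
    exists 0; first by case: (ders j).
    move=> r; rewrite lfunE mulmx0 /= sub0r /lincomb big1 ?oppr0 ?rpred0 // => i _.
    by rewrite mxE scale0r.
  move=> c x y [x0 xm xr] [y0 ym yr]; split.
  + by move=> i; rewrite addE scaleE x0 y0 scaler0 addr0.
  + move=> q s t q2; have [m mD mE] := xm q s t q2; have [m' m'D m'E] := ym q s t q2.
    exists (c *: m + m'); last exact: represents_linear.
    exact: (proj2 (ders j)).
  + by move=> i z zi; rewrite addE scaleE rpredD ?rpredZ ?xr ?yr.
- move=> j x y [x0 xm xr] [y0 ym yr]; split.
  + by move=> i; rewrite lieE x0 y0 (linear0 (der_val x)) (linear0 (der_val y)) subrr.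
  + move=> q s t q2; have [m mD mE] := xm q s t q2; have [m' m'D m'E] := ym q s t q2.
    (* The composite [x \o y] is represented by [m' *m m], whence the order. *)
    exists (lie m' m); first exact: derived_series_lie.
    have := represents_linear (-1)
      (represents_comp (@der_rad_radpow y _) m'E mE)
      (represents_comp (@der_rad_radpow x _) mE m'E).
    by rewrite !scaleN1r ![- _ + _]addrC.
  + have [jN|Nj] := ltnP j N.
      by move: jN; rewrite -subn_eq0 => /eqP -> i z zi; rewrite addn0 der_rad_radpow.
    have drop (d : DerRad A) : (forall i, d (eps i) = 0) ->
      (forall q s t, (q < 2)%N -> exists2 m : 'M[K]_n, derived_series j m &
        represents (us (q, s, t)) (radpow A q.+1) d m) ->
      forall i z, z \in radpow A i -> d z \in radpow A i.+1.
      move=> d0 dm; apply: der_rad_radpowS => q z q2 zq.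
      rewrite [z]peirce_sum !linear_sum /=; apply: rpred_sum => s _.
      rewrite linear_sum /=; apply: rpred_sum => t _.
      have [m mD mE] := dm q s t q2.
      apply: (represents0_block (@der_rad_radpow d _) (usE (q, s, t) q2) _ zq).
      suff <- : m = 0 by [].
      by have := derived_series_le Nj mD; rewrite glN.
    move=> i z zi; rewrite lieE subSn // addnS.
    by apply: rpredB; apply: drop => //; [exact: yr | exact: xr].
- move=> x; have [y y0 xy] := der_rad_normalize x; exists y => //; split=> //.
    move=> q s t q2; have /der_radP[yD _] := valP y.
    have yE z : y (eps s * z * eps t) = eps s * y z * eps t.
      by rewrite !yD !y0 mul0r add0r mulr0 addr0.
    have [m mE] := represents_exists (@der_rad_radpow y q) yE (usE (q, s, t) q2).
    by exists m.
  by move=> i z zi; rewrite sub0n addn0 der_rad_radpow.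
move=> d [_ _ dr]; apply/val_inj/lfunP => x; rewrite lfunE; apply/eqP.
by have := dr 0%N x (memvf _); rewrite add0n addKn radM memv0.
Qed.

End SolvableCriterion.

(** * Quotients of the regular module *)

Section QuotientModule.
Context (K : fieldType) (A : falgType K) (U : {vspace A}).
Hypothesis Ul : left_ideal U.

Local Notation W := (U^C)%VS.

(** The quotient [A / U] is realised on a linear complement of [U], onto which
    [A] is projected along [U]. *)
Definition quot_proj : 'Hom(A, subvs_of W) := (linfun (vsproj W) \o daddv_pi W U)%VF.

Lemma quot_projE x : quot_proj x = vsproj W (daddv_pi W U x).
Proof. by rewrite comp_lfunE lfunE. Qed.

Let dis : (W :&: U = 0)%VS. Proof. by rewrite capvC capv_compl. Qed.

Lemma quot_proj_val v : quot_proj (vsval v) = v.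
Proof. by rewrite quot_projE daddv_pi_id ?dis ?subvsP ?vsvalK. Qed.

Lemma quot_projK x : x - vsval (quot_proj x) \in U.
Proof.
rewrite quot_projE vsprojK ?memv_pi //.
have xT : x \in (W + U)%VS by rewrite addvC addv_complf memvf.
by rewrite -{1}(daddv_pi_add dis xT) addrC addKr memv_pi.
Qed.

Lemma quot_proj_eq0 x : (quot_proj x == 0) = (x \in U).
Proof.
apply/eqP/idP => [x0|xU].
  by have := quot_projK x; rewrite x0 /= subr0.
have : vsval (quot_proj x) \in (W :&: U)%VS.
  rewrite memv_cap subvsP /= -[vsval _](subKr x).
  by rewrite rpredB // quot_projK.
rewrite dis memv0 => /eqP x0; apply/val_inj; exact: x0.
Qed.

Definition quot_end a : 'End(subvs_of W) :=
  (quot_proj \o (amull a \o linfun vsval))%VF.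

Lemma quot_endE a v : quot_end a v = quot_proj (a * vsval v).
Proof. by rewrite !comp_lfunE !lfunE. Qed.

Lemma quot_end_proj a x : quot_end a (quot_proj x) = quot_proj (a * x).
Proof.
rewrite quot_endE; apply/eqP; rewrite -subr_eq0 -linearB /= quot_proj_eq0 -mulrBr.
by apply: (left_idealP _ Ul); rewrite -rpredN opprB quot_projK.
Qed.

Fact quot_end_linear : linear quot_end.
Proof.
move=> c a b; apply/lfunP => v.
by rewrite add_lfunE scale_lfunE !quot_endE mulrDl -scalerAl linearP.
Qed.

HB.instance Definition _ :=
  GRing.isLinear.Build K A 'End(subvs_of W) _ quot_end quot_end_linear.

Fact quot_act1 : linfun quot_end 1 = \1%VF.
Proof.
by apply/lfunP => v; rewrite lfunE /= quot_endE mul1r quot_proj_val id_lfunE.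
Qed.

Fact quot_actM a b : linfun quot_end (a * b) = (linfun quot_end a \o linfun quot_end b)%VF.
Proof.
have actE c v : linfun quot_end c v = quot_end c v by rewrite lfunE.
apply/lfunP => v; rewrite comp_lfunE !actE -[v]quot_proj_val.
by rewrite !quot_end_proj mulrA.
Qed.

Definition quot_mod : fdmod A := FdMod quot_act1 quot_actM.

Lemma quot_mod_actE a x : mod_act quot_mod a (quot_proj x) = quot_proj (a * x).
Proof. by rewrite -quot_end_proj /= lfunE. Qed.

Lemma dim_quot_mod : (\dim {: quot_mod} <= \dim {:A})%N.
Proof. rewrite dimvf; exact: (dimvS (subvf _)). Qed.

End QuotientModule.

(** * Indecomposable quotients *)

Section LocalModules.
Context (k : closedFieldType) (A : falgType k).
Implicit Types (a b e f v x y z : A) (U : {vspace A}).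
Local Notation J := (jrad A).

Lemma primitive_corner_unit e v c : e * e = e -> e * v * e - c *: e \in J -> c != 0 ->
  exists b, b * (e * v * e) = e.
Proof.
move=> ee vJ c0; set j := _ - _ in vJ.
have [b bE] := @jrad_left_unit _ _ (- c^-1 *: j) (rpredZ _ vJ).
exists (c^-1 *: b).
have je : j * e = j by rewrite /j mulrBl -scalerAl -!mulrA ee.
have -> : e * v * e = c *: ((1 - (- c^-1 *: j)) * e).
  rewrite mulrBl mul1r -scalerAl je scaleNr opprK scalerDr scalerA divff // scale1r.
  by rewrite addrC subrK.
by rewrite -scalerAr -scalerAl scalerA divff // scale1r mulrA bE mul1r.
Qed.

(** [A / U] is a nonzero quotient of the local module [A e]. If [V + W] is
    everything, the class of [e] is a sum of classes of [v] in [V] and [e - v] in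
    [W]; one of [e * v * e] and [e * (e - v) * e] is a unit of [e A e], and the
    submodule in question contains the class of the generator [e]. *)
Lemma quot_mod_indecomposable e U (Ul : left_ideal U) : primitive_idempotent e ->
  (forall a, a * (1 - e) \in U) -> e \notin U -> indecomposable (quot_mod Ul).
Proof.
move=> pe eU eNU; have [ee e0 _] := pe; pose pi := quot_proj U.
have pi0 x : (pi x == 0) = (x \in U) by exact: quot_proj_eq0.
have pie x : pi (x * e) = pi x.
  apply/eqP; rewrite -subr_eq0 -linearB /= pi0 -rpredN opprB.
  by rewrite -{1}[x]mulr1 -mulrBr.
have full (X : {vspace quot_mod Ul}) c v : is_submod X -> pi v \in X ->
    e * v * e - c *: e \in J -> c != 0 -> X = fullv.
  move=> Xs vX vE c0; have [b bE] := primitive_corner_unit ee vE c0.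
  apply/eqP; rewrite eqEsubv subvf /=; apply/subvP => w _.
  rewrite -[w]quot_proj_val -/pi -pie -bE mulrA.
  rewrite -[_ * (e * v * e)]mulrA -!mulrA -/pi.
  have -> : pi (vsval w * (b * (e * (v * e)))) =
      mod_act (quot_mod Ul) (vsval w * b * e) (pi v).
    by rewrite quot_mod_actE -/pi -[RHS]pie !mulrA.
  exact: Xs.
split.
  rewrite lt0n dimv_eq0; apply: contra eNU => /eqP M0.
  by rewrite -pi0 -memv0 -M0 memvf.
move=> V W Vs Ws VW VIW.
have : pi e \in (V + W)%VS by rewrite VW memvf.
case/memv_addP => v' v'V [w' w'W eE].
pose v := vsval v'; have piv : pi v = v' by exact: quot_proj_val.
have piw : pi (e - v) = w' by rewrite linearB /= piv eE addrC addKr.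
have [c cE] := primitive_corner pe v.
have [c0|c0] := eqVneq c 0; last first.
  by right; move: VIW; rewrite (full V c v) ?piv // capfv.
left; move: VIW; rewrite (full W 1 (e - v)) ?piw ?oner_eq0 ?capvf //.
rewrite mulrBr mulrBl !ee scale1r addrC addrA addNr add0r rpredN.
by move: cE; rewrite c0 scale0r subr0.
Qed.

End LocalModules.

(** * The two-parameter family of three independent radical elements *)

Section KroneckerFamily.
Context (k : closedFieldType) (A : falgType k).
Implicit Types (a b : k) (e f x y z u v : A) (M N : fdmod A).
Local Notation J := (jrad A).
Local Notation J2 := (radpow A 2).

(** [M] is in the fibre over the point [(1 : a : b)] of the projective plane of
    ratios of the actions of [x], [y] and [z]. *)
Definition at_point x y z M a b :=
  [/\ mod_act M x != 0, mod_act M y = a *: mod_act M x &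
      mod_act M z = b *: mod_act M x].

Lemma at_point_iso x y z M N a b :
  mod_iso M N -> at_point x y z M a b -> at_point x y z N a b.
Proof.
move=> [h [[g gK hK] hM]] [x0 yE zE].
have transfer u c : mod_act M u = c *: mod_act M x -> mod_act N u = c *: mod_act N x.
  move=> uE; apply/lfunP => w; rewrite -[w]hK -hM uE.
  by rewrite !scale_lfunE linearZ /= hM.
split; [|exact: transfer yE|exact: transfer zE].
apply: contraNneq x0 => x0; apply/eqP/lfunP => v; apply: (can_inj gK).
by rewrite hM x0 !zero_lfunE linear0.
Qed.

(** The module is [A / U] with [U] generated by [1 - f], the square of the
    radical, [y - a x] and [z - b x]. Modulo the radical the corners [e A e] and
    [f A f] consist of scalars. For [f A f], this makes [y - a x] and [z - b x]
    annihilate all of [A / U], and not only the class of [1]. For [e A e], it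
    shows that [U] meets the block [e J f / e J^2 f] only in the span of
    [y - a x] and [z - b x], which does not contain [x]. *)
Lemma indecomposable_at_point e f x y z a b :
  primitive_idempotent e -> primitive_idempotent f ->
  [/\ x \in J, e * x = x & x * f = x] ->
  [/\ y \in J, e * y = y & y * f = y] ->
  [/\ z \in J, e * z = z & z * f = z] ->
  x \notin J2 -> y \notin (J2 + <[x]>)%VS -> z \notin (J2 + <[x]> + <[y]>)%VS ->
  exists M, [/\ indecomposable M, (\dim {:M} <= \dim {:A})%N & at_point x y z M a b].
Proof.
move=> pe pf [xJ ex xf] [yJ ey yf] [zJ ez zf] x0 y0 z0.
have [[ee e0 _] [ff f0 _]] := (pe, pf).
(* Kept opaque: distributivity must treat [y'] and [z'] as single factors. *)
have [y' y'E] : exists y', y' = y - a *: x by eexists.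
have [z' z'E] : exists z', z' = z - b *: x by eexists.
have [ey' y'f] : e * y' = y' /\ y' * f = y'.
  by rewrite y'E mulrBr mulrBl -scalerAr -scalerAl ex xf ey yf.
have [ez' z'f] : e * z' = z' /\ z' * f = z'.
  by rewrite z'E mulrBr mulrBl -scalerAr -scalerAl ex xf ez zf.
have y'J : y' \in J by rewrite y'E rpredB ?rpredZ.
have z'J : z' \in J by rewrite z'E rpredB ?rpredZ.
pose U : {vspace A} := (Aidem (1 - f) + J2 + Aidem y' + Aidem z')%VS.
have UP u : reflect (exists r s t w, s \in J2 /\ u = r * (1 - f) + s + t * y' + w * z')
    (u \in U).
  apply: (iffP memv_addP) => [[_ /memv_addP[_ /memv_addP[_ /memv_cosetP[r _ ->]
      [s sJ ->]] [_ /memv_cosetP[t _ ->] ->]] [_ /memv_cosetP[w _ ->] ->]]|].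
    by exists r, s, t, w.
  move=> [r [s [t [w [sJ ->]]]]]; exists (r * (1 - f) + s + t * y'); last first.
    by exists (w * z') => //; rewrite memv_mul ?memvf ?memv_line.
  by rewrite !memv_add // memv_mul ?memvf ?memv_line.
have Ul : left_ideal U.
  apply/left_idealP => c u /UP[r [s [t [w [sJ ->]]]]]; apply/UP.
  exists (c * r), (c * s), (c * t), (c * w); split; first exact: radpow_mull.
  by rewrite !mulrDr !mulrA.
have idU c : c * (1 - f) \in U.
  by apply/UP; exists c, 0, 0, 0; rewrite rpred0 !mul0r !addr0.
have JU u : u \in J2 -> u \in U.
  by move=> uJ; apply/UP; exists 0, u, 0, 0; rewrite !mul0r add0r !addr0.
have y'U : y' \in U.
  by apply/UP; exists 0, 0, 1, 0; rewrite rpred0 !mul0r mul1r !addr0 add0r.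
have z'U : z' \in U.
  by apply/UP; exists 0, 0, 0, 1; rewrite rpred0 !mul0r mul1r !addr0 add0r.
have f1f : (1 - f) * f = 0 by rewrite mulrBl mul1r ff subrr.
have fU : f \notin U.
  apply/negP => /UP[r [s [t [w [sJ fE]]]]].
  case/negP: (primitive_notin_jrad pf).
  have -> : f = s * f + t * y' + w * z'.
    rewrite -{1}ff {1}fE !mulrDl -(mulrA r) f1f mulr0 add0r.
    by rewrite -(mulrA t) y'f -(mulrA w) z'f.
  have sJ' : s \in J by have := subvP (radpow_le A (leqnSn 1)) _ sJ; rewrite radpow1.
  by apply: rpredD; [apply: rpredD; [exact: jrad_mulr | exact: jrad_mull] | exact: jrad_mull].
have xU : x \notin U.
  apply/negP => /UP[r [s [t [w [sJ xE]]]]].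
  have [c cE] := primitive_corner pe t; have [d dE] := primitive_corner pe w.
  have {}xE : x = e * s * f + e * t * e * y' + e * w * e * z'.
    move: xE f1f; move: (1 - f) => g xE f1f.
    rewrite -xf -ex {1}xE !(mulrDr, mulrDl) !mulrA -(mulrA _ g f) f1f mulr0 add0r.
    by rewrite -!(mulrA _ e) !(ey', ez') -!(mulrA _ _ f) !(y'f, z'f).
  have corner t' c' w' : e * t' * e - c' *: e \in J -> w' \in J -> e * w' = w' ->
      e * t' * e * w' - c' *: w' \in J2.
    move=> tE wJ ew; have -> : e * t' * e * w' - c' *: w' = (e * t' * e - c' *: e) * w'.
      by rewrite mulrBl -scalerAl ew.
    by rewrite radpowS radpow1 memv_mul.
  have {}xE : x - (c *: y' + d *: z') \in J2.
    have -> : x - (c *: y' + d *: z') = e * s * f + (e * t * e * y' - c *: y')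
        + (e * w * e * z' - d *: z').
      by rewrite {1}xE opprD !addrA -!(addrAC _ _ (- (c *: y'))).
    apply: rpredD; [apply: rpredD | exact: corner]; last exact: corner.
    exact/radpow_mulr/radpow_mull.
  have xX : x \in (J2 + <[x]>)%VS by apply: (subvP (addvSr _ _)); exact: memv_line.
  have JX u : u \in J2 -> u \in (J2 + <[x]>)%VS by apply/subvP/addvSl.
  have XY u : u \in (J2 + <[x]>)%VS -> u \in (J2 + <[x]> + <[y]>)%VS.
    by apply/subvP/addvSl.
  have yY : y \in (J2 + <[x]> + <[y]>)%VS.
    by apply: (subvP (addvSr _ _)); exact: memv_line.
  have [d0|d0] := eqVneq d 0; last first.
    case/negP: z0.
    have -> : z = d^-1 *: (x - c *: y' - (x - (c *: y' + d *: z'))) + b *: x.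
      have -> : x - c *: y' - (x - (c *: y' + d *: z')) = d *: z'.
        by rewrite opprB addrC addrA subrK addrC addKr.
      by rewrite scalerA mulVf // scale1r z'E subrK.
    apply: rpredD; last by rewrite rpredZ ?XY.
    apply/rpredZ/rpredB; last exact/XY/JX.
    by apply: rpredB; [exact: XY _ xX | rewrite rpredZ // y'E rpredB // rpredZ // XY].
  have [c0|c0] := eqVneq c 0; last first.
    case/negP: y0.
    have -> : y = c^-1 *: (x - (x - (c *: y' + d *: z'))) + a *: x.
      by rewrite subKr d0 scale0r addr0 scalerA mulVf // scale1r y'E subrK.
    apply: rpredD; last exact: rpredZ.
    by apply/rpredZ/rpredB; last exact: JX.
  by case/negP: x0; move: xE; rewrite c0 d0 !scale0r addr0 subr0.
pose M := quot_mod Ul; exists M; split.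
- exact: quot_mod_indecomposable pf _ fU.
- exact: dim_quot_mod.
have vanish u : u \in J -> u * f = u -> u \in U -> mod_act M u = 0.
  move=> uJ uf uU; apply/lfunP => v; rewrite zero_lfunE -[v]quot_proj_val.
  rewrite quot_mod_actE; apply/eqP; rewrite quot_proj_eq0 //.
  set t := vsval v; have [c cE] := primitive_corner pf t.
  have -> : u * t = u * t * (1 - f) + (u * (f * t * f - c *: f) + c *: u).
    rewrite mulrBr mulr1 mulrBr -scalerAr !mulrA uf subrK.
    by rewrite subrK.
  rewrite !rpredD ?rpredZ // JU //.
  by rewrite radpowS radpow1 memv_mul.
split.
- apply: contra xU => /eqP x0'; rewrite -quot_proj_eq0 -[x]mulr1.
  by rewrite -(quot_mod_actE Ul) -/M x0' zero_lfunE.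
- by apply/eqP; rewrite -subr_eq0 -linearZ -linearB /= -y'E vanish.
by apply/eqP; rewrite -subr_eq0 -linearZ -linearB /= -z'E vanish.
Qed.

End KroneckerFamily.

Section Covering.
Context (k : closedFieldType).
Implicit Types (t : {poly k} * {poly k} * {poly k}).

(** [(a, b)] is a value of the rational curve [(G / F, H / F)] at a point where
    [F] does not vanish, for [t = (F, G, H)]. *)
Definition on_curve t (a b : k) := exists l,
  [/\ t.1.1.[l] != 0, t.1.2.[l] = a * t.1.1.[l] & t.2.[l] = b * t.1.1.[l]].

(** Finitely many rational curves do not cover the plane: a generic line
    [X = a] meets each of them in finitely many points. *)
Lemma curves_not_covering (C : seq ({poly k} * {poly k} * {poly k})) :
  exists a b, forall t, t \in C -> ~ on_curve t a b.
Proof.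
have [a aE] : exists a, forall t, t \in C -> t.1.1 != 0 -> t.1.2 - a *: t.1.1 != 0.
  (* A coefficient of [G - a F] as a polynomial in [a], taken at the
     degree of [F] so as not to vanish identically. *)
  pose P t : {poly k} := if t.1.1 == 0 then 1
    else (t.1.2`_(size t.1.1).-1)%:P - lead_coef t.1.1 *: 'X.
  have P0 : \prod_(t <- C) P t != 0.
    rewrite prodf_seq_neq0; apply/allP => t _ /=; rewrite /P; have [_|F0] := eqVneq t.1.1 0.
      exact: oner_neq0.
    apply/eqP => /(congr1 (fun p : {poly k} => p`_1)) /eqP.
    rewrite coefB coefC coefZ coefX /= mulr1 coef0 sub0r oppr_eq0.
    by rewrite lead_coef_eq0 (negPf F0).
  have [a aP] := closed_nonrootP _ P0; exists a => t tC F0.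
  apply: contra aP => /eqP E; rewrite (big_rem _ tC) /= rootM; apply/orP; left.
  rewrite /P (negPf F0) /root !hornerE.
  have := congr1 (fun p : {poly k} => p`_(size t.1.1).-1) E.
  by rewrite coefB coefZ coef0 lead_coefE [a * _]mulrC => ->.
pose R t := sval (closed_field_poly_normal (t.1.2 - a *: t.1.1)).
have RE t : t \in C -> t.1.1 != 0 -> forall l, t.1.2.[l] = a * t.1.1.[l] -> l \in R t.
  move=> tC F0 l lE; rewrite /R; case: closed_field_poly_normal => r /= rE.
  rewrite -root_prod_XsubC -(rootZ _ _ (_ : lead_coef (t.1.2 - a *: t.1.1) != 0)).
    by rewrite -rE /root !hornerE lE subrr.
  by rewrite lead_coef_eq0 aE.
pose Q : {poly k} := \prod_(t <- C) \prod_(l <- R t) ('X - (t.2.[l] / t.1.1.[l])%:P).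
have Q0 : Q != 0.
  rewrite prodf_seq_neq0; apply/allP => t _ /=; rewrite prodf_seq_neq0; apply/allP => l _ /=.
  by rewrite polyXsubC_eq0.
have [b bQ] := closed_nonrootP _ Q0; exists a, b => t tC [l [Fl Gl Hl]].
have F0 : t.1.1 != 0 by apply: contraNneq Fl => ->; rewrite horner0.
case/negP: bQ; rewrite /Q (big_rem _ tC) /= rootM; apply/orP; left.
rewrite (big_rem _ (RE t tC F0 l Gl)) /= rootM root_XsubC; apply/orP; left.
by rewrite Hl mulfK.
Qed.

End Covering.

(** * Bounds on the blocks and the theorem *)

Section NonWild.
Context (k : closedFieldType) (A : falgType k).
Implicit Types (a b : k) (e f u v x y z : A) (M N : fdmod A).
Local Notation J := (jrad A).
Local Notation J2 := (radpow A 2).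

(** A single module lies over at most one point, hence a constant curve. *)
Lemma at_point_curve x y z N :
  exists t, forall a b, at_point x y z N a b -> on_curve t a b.
Proof.
have [[a0 [b0 [x0 yE zE]]]|no] := pselect (exists a b, at_point x y z N a b); last first.
  by exists (0, 0, 0) => a b ab; case: no; exists a, b.
exists (1, a0%:P, b0%:P) => a b [_ yE' zE'].
have scal_inj c d : c *: mod_act N x = d *: mod_act N x -> c = d.
  move/eqP; rewrite -subr_eq0 -scalerBl scaler_eq0 (negPf x0) orbF subr_eq0.
  by move/eqP.
exists 0; rewrite /= !hornerE oner_neq0 ?mulr1.
by split=> //; apply: scal_inj; rewrite -?yE -?zE.
Qed.

(** Any nonzero entry of the matrix of [x] gives the ratios at [l]. *)
Lemma at_point_specialize x y z (B : free_bimod A) l a b :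
  at_point x y z (specialize B l) a b ->
  exists i j, on_curve (bimod_act B x i j, bimod_act B y i j, bimod_act B z i j) a b.
Proof.
move=> [x0 yE zE].
have specE u c : mod_act (specialize B l) u = c *: mod_act (specialize B l) x ->
    spec_mx B l u = c *: spec_mx B l x.
  move=> uE; apply/matrixP => i j.
  have : spec_act B l u (delta_mx j 0) = c *: spec_act B l x (delta_mx j 0).
    by rewrite -scale_lfunE; exact: (congr1 (fun h : 'End('cV[k]_(bimod_rank B)) => h _) uE).
  by rewrite !spec_actE -!colE => /matrixP/(_ i 0); rewrite !mxE.
have [i [j ij0]] : exists i j, spec_mx B l x i j != 0.
  apply: contrapT => no; case/eqP: x0; apply/lfunP => v.
  rewrite spec_actE (_ : spec_mx B l x = 0) ?mul0mx ?zero_lfunE //.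
  apply/matrixP => i j; rewrite [RHS]mxE; apply/eqP; apply: contrapT => /negP ij.
  by apply: no; exists i, j.
exists i, j, l; move: ij0; rewrite /= /spec_mx mxE => ij0; split=> //.
  by have := congr1 (fun m : 'M_ _ => m i j) (specE _ _ yE); rewrite /spec_mx !mxE.
by have := congr1 (fun m : 'M_ _ => m i j) (specE _ _ zE); rewrite /spec_mx !mxE.
Qed.

(** A bound [D] on the dimension is needed in the tame case, where each
    dimension has its own finite list of families. *)
Lemma non_wild_curves x y z D : non_wild A ->
  exists C : seq ({poly k} * {poly k} * {poly k}), forall M a b,
    indecomposable M -> (\dim {:M} <= D)%N -> at_point x y z M a b ->
    exists2 t, t \in C & on_curve t a b.
Proof.
have fixedC n (N : 'I_n -> fdmod A) :
    exists C : seq ({poly k} * {poly k} * {poly k}), forall M i a b,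
    mod_iso M (N i) -> at_point x y z M a b -> exists2 t, t \in C & on_curve t a b.
  have /choice[t tE] := fun i => at_point_curve x y z (N i).
  exists [seq t i | i <- enum 'I_n] => M i a b MN Mab; exists (t i).
    by rewrite map_f ?mem_enum.
  exact/tE/(at_point_iso MN).
case=> [[n [N NE]]|tame].
  have [C CE] := fixedC n N; exists C => M a b Mi _ Mab.
  by have [i MN] := NE M Mi; exact: CE MN Mab.
elim: D => [|D [C CE]].
  by exists [::] => M a b [M0 _]; rewrite leqNgt M0.
have [m [B [n [N NE]]]] := tame D.+1.
have [C' C'E] := fixedC n N.
pose C'' := [seq (bimod_act (B i) x p.1 p.2, bimod_act (B i) y p.1 p.2,
                  bimod_act (B i) z p.1 p.2)
  | i <- enum 'I_m, p <- enum {: 'I_(bimod_rank (B i)) * 'I_(bimod_rank (B i))}].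
exists (C ++ C' ++ C'') => M a b Mi; rewrite leq_eqVlt => /orP[/eqP MD|MD] Mab.
  have [[i MN]|[i [l MB]]] := NE M Mi MD.
    have [t tC tE] := C'E M i a b MN Mab.
    by exists t => //; rewrite !mem_cat tC orbT.
  have [p [q pq]] := at_point_specialize (at_point_iso MB Mab).
  eexists; last exact: pq; rewrite !mem_cat; apply/orP; right; apply/orP; right.
  by apply/allpairsPdep; exists i, (p, q); rewrite !mem_enum.
have [t tC tE] := CE M a b Mi MD Mab.
by exists t => //; rewrite mem_cat tC.
Qed.

Lemma peirce_mem e f x0 : e * e = e -> f * f = f -> x0 \in J ->
  [/\ e * x0 * f \in J, e * (e * x0 * f) = e * x0 * f & (e * x0 * f) * f = e * x0 * f].
Proof.
by move=> ee ff xJ; rewrite !mulrA ee -(mulrA _ f f) ff; split=> //; exact/jrad_mulr/jrad_mull.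
Qed.

(** Otherwise [e J f / e J^2 f] would contain three independent classes, and the
    two-parameter family of modules attached to them would be covered by
    finitely many curves. *)
Lemma non_wild_block e f : non_wild A ->
  primitive_idempotent e -> primitive_idempotent f ->
  exists us : 'I_2 -> A, spans_block e f J J2 us.
Proof.
move=> nw pe pf; have [[ee e0 _] [ff f0 _]] := (pe, pf).
pose X x := [/\ x \in J, e * x = x & x * f = x].
have Xpeirce x : x \in J -> X (e * x * f) by exact: peirce_mem.
have mk (u v : A) : X u -> X v -> (forall x, X x -> x \in (J2 + <[u]> + <[v]>)%VS) ->
    exists us : 'I_2 -> A, spans_block e f J J2 us.
  move=> [uJ eu uf] [vJ ev vf] span; exists (fun i => if i == 0 then u else v).
  split=> [i|x xJ]; first by case: (i == 0); rewrite ?eu ?uf ?ev ?vf.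
  have /memv_addP[_ /memv_addP[w wJ [_ /vlineP[c ->] ->]] [_ /vlineP[d ->] ->]] :=
    span _ (Xpeirce x xJ).
  exists (\row_i if i == 0 then c else d).
  rewrite /lincomb big_ord_recl big_ord1 !mxE /=.
  by rewrite -(addrA w) addrK.
have zeroX : X 0 by rewrite /X !mul0r mulr0 rpred0.
have [allJ|] := pselect (forall x, X x -> x \in J2).
  by apply: (mk 0 0) => // x /allJ xJ; do 2!apply: (subvP (addvSl _ _)).
move=> /existsNP[x /not_implyP[Xx /negP x0]].
have [allx|] := pselect (forall y, X y -> y \in (J2 + <[x]>)%VS).
  by apply: (mk x 0) => // y /allx yJ; apply: (subvP (addvSl _ _)).
move=> /existsNP[y /not_implyP[Xy /negP y0]].
have [ally|] := pselect (forall z, X z -> z \in (J2 + <[x]> + <[y]>)%VS).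
  exact: (mk x y).
move=> /existsNP[z /not_implyP[Xz /negP z0]]; exfalso.
have [C CE] := non_wild_curves x y z (\dim {:A}) nw.
have [a [b abC]] := curves_not_covering C.
have [M [Mi Md Mab]] := indecomposable_at_point a b pe pf Xx Xy Xz x0 y0 z0.
by have [t tC /(abC t tC)] := CE M a b Mi Md Mab.
Qed.

Lemma top_block n e f : primitive_idempotent e -> primitive_idempotent f ->
  exists us : 'I_n.+1 -> A, spans_block e f (radpow A 0) (radpow A 1) us.
Proof.
move=> pe pf; have [[ee e0 _] [ff f0 _]] := (pe, pf).
have [u uE] := primitive_hom_top pe pf; exists (fun=> e * u * f).
split=> [i|x _]; first by rewrite memvf !mulrA ee -(mulrA _ f f) ff.
have [c cE] := uE x; exists (c *: delta_mx 0 0); rewrite radpow1 /lincomb.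
rewrite big_ord_recl !mxE !eqxx mulr1 big1 ?addr0 // => i _.
by rewrite !mxE /= mulr0 scale0r.
Qed.

Lemma HH1_rad_solvable n : lie_solvable 'M[k]_n.+1 ->
  (forall e f, primitive_idempotent e -> primitive_idempotent f ->
     exists us : 'I_n.+1 -> A, spans_block e f J J2 us) ->
  lie_solvable (HH1_rad A).
Proof.
move=> gl_solv blocks.
have [I [eps [prim _ orth sum1]]] := idempotent_decomposition (mulr1 (1 : A)).
apply: (HH1_rad_solvable_of_blocks (eps := eps) _ orth sum1 gl_solv).
  by move=> i; case: (prim i).
case=> [|[|//]] s t _; first exact: top_block.
by rewrite radpow1; exact: blocks.
Qed.

End NonWild.

Section SeparatedQuiver.
Context (k : closedFieldType) (A : falgType k).
Implicit Types (e f p q u v x y z : A).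
Local Notation J := (jrad A).
Local Notation J2 := (radpow A 2).

(** Two arrows from [i] to [j] become two edges between [i] and [j']. *)
Lemma no_A1_tilde_arrows (Q : quiver) :
  ~ contains_graph (underlying_graph (separated_quiver Q)) A1_tilde ->
  forall i j : vertex Q, (#|[pred a : arrow Q | (source a == i) && (target a == j)]| <= 1)%N.
Proof.
move=> noA1 i j; rewrite leqNgt; apply/negP => /card_gt1P[a [a' [aij a'ij aa']]].
apply: noA1; exists (fun c : bool => if c then inl i else inr j).
exists (fun c : bool => if c then a else a'); split.
- by move=> [] [].
- by move=> [] [] //= E; move: aa'; rewrite E eqxx.
have imset_bool (T : finType) (h : bool -> T) :
    (h @: [set: bool] = [set h true; h false])%SET.
  apply/setP => w; rewrite !inE; apply/imsetP/orP.
    by case=> -[] _ ->; rewrite eqxx; [left | right].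
  by case=> /eqP ->; [exists true | exists false]; rewrite ?inE.
move=> c; rewrite [RHS]imset_bool /=.
move: aij a'ij; rewrite !inE => /andP[/eqP <- /eqP <-] /andP[/eqP E1 /eqP E2].
by case: c => //; rewrite E1 E2.
Qed.

Lemma dim_rad_rad2_le1_block e f : e * e = e -> f * f = f -> (dim_rad_rad2 e f <= 1)%N ->
  exists u, [/\ u \in J, e * u = u, u * f = u &
    forall x, x \in J -> exists c, e * x * f - c *: u \in J2].
Proof.
move=> ee ff; rewrite /dim_rad_rad2 -radpow2; set D := (_ + _)%VS => dimD.
have inD x : x \in J -> e * x * f \in D.
  by move=> xJ; apply: (subvP (addvSl _ _)); rewrite !memv_mul ?memv_line.
have [allJ|] := pselect (forall x, x \in J -> e * x * f \in J2).
  exists 0; rewrite rpred0 mulr0 mul0r; split=> // x xJ.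
  by exists 0; rewrite scale0r subr0 allJ.
move=> /existsNP[u0 /not_implyP[uJ /negP u0J2]]; set u := e * u0 * f in u0J2.
have [uJ' eu uf] := peirce_mem ee ff uJ; exists u; split=> // x xJ.
suff: e * x * f \in (J2 + <[u]>)%VS.
  by case/memv_addP => v vV [_ /vlineP[c ->] ->]; exists c; rewrite addrK.
apply: contraLR dimD => xu; rewrite -ltnNge ltn_subRL addn1.
have step (V : {vspace A}) v : v \notin V -> (\dim V < \dim (V + <[v]>))%N.
  move=> vV; rewrite ltn_neqAle dimvS ?addvSl // andbT.
  apply: contra vV => /eqP dV; have /eqP -> : (V == V + <[v]>)%VS.
    by rewrite eqEdim addvSl dV leqnn.
  by apply: (subvP (addvSr _ _)); exact: memv_line.
apply: leq_ltn_trans (step _ _ u0J2) _; apply: leq_trans (step _ _ xu) _.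
by apply: dimvS; rewrite !subv_add addvSr -!memvE !inD.
Qed.

(** Isomorphisms from [A e] and [A f] to representatives [A (eps i)] and
    [A (eps j)] carry the block of [e] and [f] to that of [eps i] and [eps j]. *)
Lemma gabriel_block (Q : quiver) e f : is_gabriel_quiver A Q ->
  ~ contains_graph (underlying_graph (separated_quiver Q)) A1_tilde ->
  primitive_idempotent e -> primitive_idempotent f ->
  exists us : 'I_1 -> A, spans_block e f J J2 us.
Proof.
move=> [eps [prim _ surj arrows]] noA1 pe pf; have [[ee e0 _] [ff f0 _]] := (pe, pf).
have [i isoe] := surj e pe; have [j isof] := surj f pf.
have [[ii _ _] [jj _ _]] := (prim i, prim j).
have [p [q [pq qp ep fq]]] := left_ideal_iso_idem ee ii isoe.
have [p' [q' [pq' qp' ep' fq']]] := left_ideal_iso_idem ff jj isof.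
have ep0 : e * p = p by rewrite -ep !mulrA ee.
have qf' : q' * f = q' by rewrite -fq' -!mulrA ff.
have pi : p * eps i = p by rewrite -ep -!mulrA ii.
have jq' : eps j * q' = q' by rewrite -fq' !mulrA jj.
have dim1 : (dim_rad_rad2 (eps i) (eps j) <= 1)%N.
  by rewrite -arrows; exact: no_A1_tilde_arrows.
have [u [uJ iu uj span]] := dim_rad_rad2_le1_block ii jj dim1.
exists (fun=> p * u * q'); split=> [_|x xJ].
  split; first exact/jrad_mulr/jrad_mull.
  by rewrite !mulrA ep0 -(mulrA _ q' f) qf'.
have [c cE] := span (q * x * p') (jrad_mulr _ (jrad_mull _ xJ)).
exists (const_mx c); rewrite /lincomb big_ord1 mxE.
have -> : e * x * f - c *: (p * u * q') = p * (eps i * (q * x * p') * eps j - c *: u) * q'.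
  rewrite mulrBr mulrBl -scalerAr -scalerAl; congr (_ - _).
  by rewrite !mulrA pi -!(mulrA _ (eps j)) jq' -pq -pq' !mulrA.
exact/radpow_mulr/radpow_mull.
Qed.

End SeparatedQuiver.

Theorem theorem4p4 (k : closedFieldType) (A : falgType k) :
  non_wild A ->
  (2%N \in [pchar k] -> lie_solvable (HH1_rad A)) /\
  (2%N \notin [pchar k] ->
   forall Q : quiver, is_gabriel_quiver A Q ->
     ~ contains_graph (underlying_graph (separated_quiver Q)) A1_tilde ->
     lie_solvable (HH1_rad A)).
Proof.
move=> nw; split=> [char2|_ Q QA noA1].
  apply: (@HH1_rad_solvable _ _ 1 (gl2_solvable char2)) => e f pe pf.
  exact: non_wild_block.
apply: (@HH1_rad_solvable _ _ 0 (gl1_solvable k)) => e f pe pf.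
exact: gabriel_block QA noA1 pe pf.
Qed.
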